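(* Let $E$ be a finite set with at least three elements. The map $\mathfrak B_E:\widehat{\mathbf{Mod}}_E\to\mathbb S^{\mathrm{Quad}_E}$ endows $\widehat{\mathbf{Mod}}_E$ with a topology (the topology induced via $\mathfrak B_E$ from the product topology on $\mathbb S^{\mathrm{Quad}_E}$) that makes it compact.
   Context: $\mathbb S=\mathbb P^1(\mathbb C)$ is the Riemann sphere. A combinatorial tree marked by $E$ is a finite tree $T$ whose set of leaves (external vertices) is $E$ and all of whose internal vertices have valence at least $3$. A tree of spheres $\mathcal T$ marked by $E$ is a combinatorial tree $T$ marked by $E$ together with, for each internal vertex $v$, a Riemann sphere $\mathbb S_v$ and an injection $i_v$ of the set of edges adjacent to $v$ into $\mathbb S_v$; one defines $a_v:E\to\mathbb S_v$ by $a_v(x)=i_v(e)$, where $e$ is the edge at $v$ lying in the same connected component of $T\setminus\{v\}$ as $x$. An isomorphism between trees of spheres $\mathcal T_1,\mathcal T_2$ marked by $E$ is a bijective map $M:T_1\to T_2$ of combinatorial trees (internal vertices to internal vertices, leaves to leaves, edges to edges, adjacent vertices to adjacent vertices) restricting to the identity on $E$, together with, for each internal vertex $v$ of $T_1$, a projective isomorphism $m_v:\mathbb S_v\to\mathbb S_{M(v)}$ mapping $i_v(e)$ to $i_{M(v)}(M(e))$ for each edge $e$ at $v$. $\widehat{\mathbf{Mod}}_E$ is the set of isomorphism classes of trees of spheres marked by $E$. For a triple $t=(x_0,x_1,x_\infty)$ of distinct elements of $E$, let $v_t$ be the unique vertex of $T$ such that $x_0,x_1,x_\infty$ lie in three different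 components of $T\setminus\{v_t\}$, let $\sigma_t:\mathbb S_{v_t}\to\mathbb S$ be the unique projective isomorphism with $\sigma_t(a_{v_t}(x_0))=0$, $\sigma_t(a_{v_t}(x_1))=1$, $\sigma_t(a_{v_t}(x_\infty))=\infty$, and put $\alpha_t=\sigma_t\circ a_{v_t}:E\to\mathbb S$ (this depends only on the class $[\mathcal T]$). $\mathrm{Quad}_E$ is the set of quadruples of distinct elements of $E$, and $\mathfrak B_E([\mathcal T])=(\alpha_t(x))_{(t,x)\in\mathrm{Quad}_E}$. *)

(* Defs.v *)
From HB Require Import structures.
From mathcomp Require Import all_boot all_order all_algebra.
From mathcomp Require Import generic_quotient complex ring.
From mathcomp Require Import all_classical all_reals all_analysis.

Set Implicit Arguments.
Unset Strict Implicit.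
Unset Printing Implicit Defensive.

Import Order.TTheory GRing.Theory Num.Theory.
Import numFieldNormedType.Exports.

Local Open Scope classical_set_scope.
Local Open Scope ring_scope.
Local Open Scope quotient_scope.

Section RiemannSphere.
Variable R : realType.

Definition Cplx : numFieldType := R[i].

Definition sphere : topologicalType := one_point_compactification Cplx.

(* The point [x : y] of P^1(C); relevant only when (x, y) != (0, 0). *)
Definition hpoint (x y : Cplx) : sphere :=
  if y == 0 then None else Some (x / y).

Definition mobius (a b c d : Cplx) (z : sphere) : sphere :=
  if z is Some z' then hpoint (a * z' + b) (c * z' + d) else hpoint a c.

Definition projective_iso (f : sphere -> sphere) : Prop :=
  exists a b c d : Cplx, a * d - b * c != 0 /\ f =1 mobius a b c d.

Lemma hpointZ (k x y : Cplx) : k != 0 -> hpoint (k * x) (k * y) = hpoint x y.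
Proof.
move=> k0; rewrite /hpoint mulf_eq0 (negbTE k0) /=; case: eqP => // _.
by rewrite -mulf_div divff // mul1r.
Qed.

Lemma mobius_hpoint (a b c d x y : Cplx) : (x != 0) || (y != 0) ->
  mobius a b c d (hpoint x y) = hpoint (a * x + b * y) (c * x + d * y).
Proof.
rewrite {1}/hpoint; have [-> /=|y0 _ /=] := eqVneq y 0.
  by rewrite orbF !mulr0 !addr0 => x0; rewrite ![_ * x]mulrC hpointZ.
by rewrite -(hpointZ (k := y)) // !mulrDr ![y * _]mulrC -!mulrA mulVf // !mulr1.
Qed.

Lemma projective_iso_id : projective_iso id.
Proof.
exists 1, 0, 0, 1; split; first by rewrite mulr1 mulr0 subr0 oner_neq0.
case=> [z|] /=; rewrite /hpoint ?eqxx //.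
by rewrite mul0r add0r oner_eq0 mul1r addr0 divr1.
Qed.

Lemma projective_iso_comp f g :
  projective_iso f -> projective_iso g -> projective_iso (f \o g).
Proof.
move=> [a [b [c [d [D0 fE]]]]] [a' [b' [c' [d' [D'0 gE]]]]].
exists (a * a' + b * c'), (a * b' + b * d'), (c * a' + d * c'), (c * b' + d * d').
split.
  suff -> : (a * a' + b * c') * (c * b' + d * d')
      - (a * b' + b * d') * (c * a' + d * c')
      = (a * d - b * c) * (a' * d' - b' * c') by rewrite mulf_neq0.
  by ring.
move=> z /=; rewrite gE fE; case: z => [z|] /=; rewrite mobius_hpoint //.
- by congr hpoint; ring.
- rewrite -negb_and; apply: contra D'0 => /andP[/eqP h1 /eqP h2].
  have Hb : b' = - (a' * z) by apply/eqP; rewrite -addr_eq0 addrC h1.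
  have Hd : d' = - (c' * z) by apply/eqP; rewrite -addr_eq0 addrC h2.
  by apply/eqP; rewrite Hb Hd; ring.
- rewrite -negb_and; apply: contra D'0 => /andP[/eqP -> /eqP ->].
  by rewrite mul0r mulr0 subr0.
Qed.

Lemma projective_iso_inv f : projective_iso f ->
  exists2 g, projective_iso g & cancel f g.
Proof.
move=> [a [b [c [d [D0 fE]]]]]; exists (mobius d (- b) (- c) a).
  exists d, (- b), (- c), a; split => //.
  by rewrite mulrNN mulrC.
move=> z; rewrite fE; case: z => [z|] /=; rewrite mobius_hpoint.
- have -> : d * (a * z + b) + - b * (c * z + d) = (a * d - b * c) * z by ring.
  have -> : - c * (a * z + b) + a * (c * z + d) = (a * d - b * c) * 1 by ring.
  by rewrite hpointZ // /hpoint oner_eq0 divr1.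
- rewrite -negb_and; apply: contra D0 => /andP[/eqP h1 /eqP h2].
  have Hb : b = - (a * z) by apply/eqP; rewrite -addr_eq0 addrC h1.
  have Hd : d = - (c * z) by apply/eqP; rewrite -addr_eq0 addrC h2.
  by apply/eqP; rewrite Hb Hd; ring.
- have -> : - c * a + a * c = 0 by ring.
  by rewrite /hpoint eqxx.
- rewrite -negb_and; apply: contra D0 => /andP[/eqP -> /eqP ->].
  by rewrite mul0r mulr0 subr0.
Qed.

End RiemannSphere.

(* The vertices are the leaves (elements of E) together with internal vertices
   numbered by an ordinal type.  Up to isomorphism this is no restriction, and
   it keeps the trees in a universe where they can be quotiented. *)
Record combTree (E : finType) := CombTree {
  nint : nat;
  (* Not [rel _], whose universe is too large for the quotient below. *)
  adj : E + 'I_nint -> E + 'I_nint -> bool;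
  adj_sym : symmetric adj;
  adj_irrefl : irreflexive adj;
  adj_connected : forall u w, connect adj u w;
  (* [ucycle] counts the back-and-forth along an edge as a cycle of size 2. *)
  adj_acyclic : forall c, ucycle adj c -> (size c <= 2)%N;
  valence_leaf : forall x : E, #|[set w | adj (inl x) w]%SET| = 1%N;
  valence_int : forall v : 'I_nint, (3 <= #|[set w | adj (inr v) w]%SET|)%N }.

Definition vertex (E : finType) (T : combTree E) : finType := (E + 'I_(nint T))%type.

(* Each sphere S_v is a copy of P^1(C).  The edge between v and w is recorded,
   among the edges at v, by its other endpoint w, so [att v w] is i_v of that
   edge; its value is irrelevant when w is not adjacent to v. *)
Record sphereTree (R : realType) (E : finType) := SphereTree {
  stree :> combTree E;
  att : 'I_(nint stree) -> vertex stree -> sphere R;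
  att_inj : forall v, {in [pred w | adj (inr v) w] &, injective (att v)} }.

HB.instance Definition _ (R : realType) (E : finType) :=
  gen_eqMixin (sphereTree R E).
HB.instance Definition _ (R : realType) (E : finType) :=
  gen_choiceMixin (sphereTree R E).

(* The map of vertices that is the identity on leaves and mu on internal
   vertices. *)
Definition extv (E : finType) (n1 n2 : nat) (mu : 'I_n1 -> 'I_n2)
    (u : E + 'I_n1) : E + 'I_n2 :=
  match u with inl x => inl x | inr v => inr (mu v) end.

Section Isomorphism.
Variables (R : realType) (E : finType).
Implicit Types T : sphereTree R E.

Definition isom T1 T2 : Prop :=
  exists (mu : 'I_(nint T1) -> 'I_(nint T2))
         (m : 'I_(nint T1) -> sphere R -> sphere R),
  [/\ bijective mu,
      forall u w : vertex T1, adj (extv mu u) (extv mu w) = adj u w,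
      forall v, projective_iso (m v) &
      forall v w, adj (inr v) w -> m v (att v w) = att (mu v) (extv mu w)].

Lemma isom_refl T : isom T T.
Proof.
have ext_id (u : vertex T) : extv id u = u by case: u.
exists id, (fun=> id); split=> [|u w|_|v w _]; rewrite ?ext_id //.
- by exists id.
- exact: projective_iso_id.
Qed.

Lemma isom_trans T1 T2 T3 : isom T1 T2 -> isom T2 T3 -> isom T1 T3.
Proof.
move=> [mu [m [bmu amu pm cm]]] [nu [n [bnu anu pn cn]]].
have extM (u : vertex T1) : extv (nu \o mu) u = extv nu (extv mu u) by case: u.
exists (nu \o mu), (fun v => n (mu v) \o m v); split=> [|u w|v|v w vw].
- exact: bij_comp.
- by rewrite !extM anu amu.
- exact: projective_iso_comp.
- by rewrite extM /= cm // cn //; have := amu (inr v) w; rewrite vw /= => ->.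
Qed.

Lemma isom_sym T1 T2 : isom T1 T2 -> isom T2 T1.
Proof.
move=> [mu [m [[nu muK nuK] amu pm cm]]].
have extK (u : vertex T2) : extv mu (extv nu u) = u by case: u => //= v; rewrite nuK.
have /boolp.choice[n nP] (v : 'I_(nint T1)) :
    exists g, projective_iso g /\ cancel (m v) g.
  by have [g] := projective_iso_inv (pm v); exists g.
exists nu, (fun v => n (nu v)); split=> [|u w|v|v w vw].
- by exists mu.
- by rewrite -amu !extK.
- by case: (nP (nu v)).
- have adjvw : adj (inr (nu v) : vertex T1) (extv nu w).
    by rewrite -amu extK /= nuK.
  by have /= := cm _ _ adjvw; rewrite extK nuK => <-; case: (nP (nu v)).
Qed.

Definition isomb T1 T2 : bool := `[< isom T1 T2 >].

Lemma isomb_refl : reflexive isomb.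
Proof. by move=> T; apply/asboolP/isom_refl. Qed.

Lemma isomb_sym : symmetric isomb.
Proof. by move=> T1 T2; apply: asbool_equiv_eq; split; apply: isom_sym. Qed.

Lemma isomb_trans : transitive isomb.
Proof.
move=> T2 T1 T3 /asboolP h1 /asboolP h2.
by apply/asboolP; apply: isom_trans h1 h2.
Qed.

Canonical isomb_equiv := EquivRel isomb isomb_refl isomb_sym isomb_trans.

Definition Mod := {eq_quot isomb}.

HB.instance Definition _ := EqQuotient.on Mod.
HB.instance Definition _ := Choice.on Mod.

End Isomorphism.

Section Coordinates.
Variables (R : realType) (E : finType) (T : sphereTree R E).
Local Notation V := (vertex T).

Definition same_comp (v : 'I_(nint T)) : rel V :=
  connect [rel u w | [&& adj u w, u != inr v & w != inr v]].

(* a_v; in a tree, the edge picked below exists and is unique. *)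
Definition leafpos (v : 'I_(nint T)) (x : E) : sphere R :=
  if [pick w : V | adj (inr v) w && same_comp v w (inl x)] is Some w
  then att v w else None.

Definition separates (t : E * E * E) (v : 'I_(nint T)) : bool :=
  let: (x0, x1, xoo) := t in
  [&& ~~ same_comp v (inl x0) (inl x1), ~~ same_comp v (inl x0) (inl xoo)
    & ~~ same_comp v (inl x1) (inl xoo)].

Definition normalizes (t : E * E * E) (v : 'I_(nint T)) :
    set (sphere R -> sphere R) :=
  let: (x0, x1, xoo) := t in
  [set s | [/\ projective_iso s, s (leafpos v x0) = Some 0,
               s (leafpos v x1) = Some 1 & s (leafpos v xoo) = None]].

(* For t a triple of distinct leaves, the vertex v_t separating t and the map
   sigma_t normalizing it exist and are unique; the defaults play no role. *)
Definition alpha (t : E * E * E) (x : E) : sphere R :=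
  if [pick v | separates t v] is Some v
  then xget (fun z : sphere R => z) (normalizes t v) (leafpos v x) else None.

End Coordinates.

Definition Quad (E : finType) : Type :=
  {q : E * E * E * E | let: (x0, x1, xoo, x) := q in uniq [:: x0; x1; xoo; x]}.

Definition BE (R : realType) (E : finType) (c : Mod R E) :
    prod_topology (fun _ : Quad E => sphere R) :=
  fun q => let: (t, x) := sval q in alpha (repr c) t x.

(* Main.v *)
From HB Require Import structures.
Require Import Defs.
From mathcomp Require Import all_boot all_order all_algebra.
From mathcomp Require Import generic_quotient complex ring.
From mathcomp Require Import all_classical all_reals all_analysis.

(** The image of [BE] is cut out of the compact space of all families
    (b_q)_q of points of the sphere by closed conditions, and [BE] is injective;
    hence the topology induced by [BE] is that of a closed subspace of a compact
    Hausdorff space.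

    The closed conditions are relations between cross-ratios.  Write b_t(x) for
    the coordinate at the quadruple (t, x), completed by b_t = 0, 1, oo on t.
    If s and t are triples and x is a leaf, then b_t(x) must be the cross-ratio
    of the images of t and x under b_s.  Written in homogeneous coordinates
    ([crossrel]) this is a homogeneous polynomial relation, hence a closed
    condition ([closed_crossrel]), and it is vacuous exactly when the
    cross-ratio is undefined.  It holds in every tree of spheres
    ([BE_cross_set]): either s and t have the same separating vertex and then b_s
    and b_t differ by a projective map, or, v and m being the two
    vertices, every leaf lies in the direction of m seen from v or in the
    direction of v seen from m, and the relation degenerates ([crossrel_or]).

    Conversely, let b satisfy all these relations.  If b_s is injective on t,
    then b_t = f o b_s for a projective map f ([splits_trans]); otherwise there
    are points p and q such that each leaf x has b_s(x) = p or b_t(x) = q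
    ([splits_or]).  So a maximal family of triples that pairwise do not split
    each other can serve as the set of internal vertices, and the maps b_t as the
    maps a_v.  What remains is combinatorial: a finite set of vertices, each
    with a map to a set of directions that takes at least three values on the
    leaves, such that any two vertices satisfy the alternative above and any
    three leaves are separated by a vertex, is a tree
    for the adjacency relation of not being separated by a third vertex
    ([dir_tree]).

    A tree of spheres is recovered in the same way from its maps a_v
    ([adj_dadj], [dirs_map]), so two trees whose maps a_v agree up to projective
    maps are isomorphic ([isom_of_pos]); this gives the injectivity
    ([BE_inj]). *)

Set Implicit Arguments.
Unset Strict Implicit.
Unset Printing Implicit Defensive.

Import Order.TTheory GRing.Theory Num.Theory.
Import numFieldNormedType.Exports.

(** * Branches of a finite tree *)

Section TreeGraph.
Variables (V : finType) (e : rel V).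

(** Connectedness in the graph deprived of [v]: the classes of [avoid v] other
    than that of [v] are the branches at [v].  For [v] internal this is [same_comp v]. *)
Definition avoid (v : V) : rel V :=
  connect [rel u w | [&& e u w, u != v & w != v]].

Hypothesis esym : symmetric e.
Hypothesis eirr : irreflexive e.
Hypothesis econn : forall u w, connect e u w.
Hypothesis eacyc : forall c, ucycle e c -> (size c <= 2)%N.

Implicit Types u v w x y z m : V.

Lemma edge_neq u v : e u v -> u != v.
Proof. by apply: contraTneq => ->; rewrite eirr. Qed.

Lemma avoid_refl v u : avoid v u u.
Proof. exact: connect0. Qed.

Lemma avoid_sym v u w : avoid v u w = avoid v w u.
Proof.
apply: sym_connect_sym => a b /=; rewrite esym.
by case: (a != v); case: (b != v); rewrite ?andbT ?andbF.
Qed.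

Lemma avoid_trans v u w x : avoid v u w -> avoid v w x -> avoid v u x.
Proof. exact: connect_trans. Qed.

Lemma avoid_path v u p : path e u p -> v \notin u :: p -> avoid v u (last u p).
Proof.
elim: p u => [|w p IHp] u /=; first by rewrite avoid_refl.
case/andP=> uw pw; rewrite inE negb_or eq_sym => /andP[uv vp].
apply: avoid_trans (IHp _ pw vp); apply: connect1 => /=.
by move: vp; rewrite uw uv inE negb_or eq_sym => /andP[].
Qed.

Lemma avoid_edge v u w : e u w -> u != v -> w != v -> avoid v u w.
Proof. by move=> uw uv wv; apply: connect1; rewrite /= uw uv. Qed.

Lemma avoidP v u w : u != v -> avoid v u w ->
  exists2 p, path e u p & [/\ uniq (u :: p), v \notin u :: p & last u p = w].
Proof.
move=> uv /connectP[p0 pth0 ->]; case/shortenP: pth0 => p pth unq _.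
exists p; last split => //.
  by apply: sub_path pth => a b /= /andP[].
have h : {in p, forall a, a != v}.
  move: pth {unq}; elim: p u uv => [|a p IHp] u uv //= /andP[/and3P[_ _ av] pth] b.
  by rewrite inE => /predU1P[->//|]; exact: (IHp a av pth b).
rewrite inE negb_or eq_sym uv /=; apply/negP => vp.
by have := h v vp; rewrite eqxx.
Qed.

Lemma avoid_neq v u w : u != v -> avoid v u w -> w != v.
Proof.
move=> uv /(avoidP uv)[p _ [_ vp <-]]; apply: contraNneq vp => <-.
exact: mem_last.
Qed.

Lemma avoid_self v w : w != v -> avoid v w v = false.
Proof. by move=> wv; apply/negP => /(avoid_neq wv); rewrite eqxx. Qed.

(** Two neighbours of [v] in the same branch would close a cycle through [v]. *)
Lemma branch_unique v w w' : e v w -> e v w' -> avoid v w w' -> w = w'.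
Proof.
move=> vw vw' /avoidP; rewrite eq_sym edge_neq // => /(_ isT)[p pth [unq vp lst]].
have /eacyc : ucycle e (v :: w :: p).
  by rewrite /ucycle /= rcons_path vw pth lst esym vw' vp.
by case: p {pth unq vp} lst.
Qed.

Lemma branch_exists v u : u != v -> exists2 w, e v w & avoid v w u.
Proof.
move=> uv; case/connectP: (econn v u) => p0 pth0 lst; move: lst uv.
case/shortenP: pth0 => -[_ _ _ -> |w p]; first by rewrite eqxx.
move=> pth unq _ -> _; move: pth unq => /= /andP[vw pth] /andP[vp _].
by exists w => //; apply: avoid_path.
Qed.

(** A simple path from [a] to [v] that meets [m] reaches it before [v]. *)
Lemma avoid_or v m a : v != m -> avoid v a m || avoid m a v.
Proof.
move=> vm; case/connectP: (econn a v) => p0 pth0 lst; move: lst.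
case/shortenP: pth0 => p pth unq _ lst.
have [|ma] := boolP (m \in a :: p); last by rewrite lst (avoid_path pth) ?orbT.
move=> ma; case/splitPl: ma pth unq lst => p1 p2 mE.
rewrite cat_path last_cat mE -cat_cons cat_uniq => /andP[pth1 _].
case/and3P => _ dis _ vE; rewrite -{1}mE avoid_path //.
apply: contra dis => vp1; apply/hasP; exists v => //.
case: p2 vE => [/= vE|b p2 ->]; last by rewrite /= mem_last.
by rewrite vE eqxx in vm.
Qed.

(** Removing the edge from [v] to [w] disconnects the graph, so [y] cannot be on
    the side of [w] seen from [v] and on the side of [v] seen from [w]. *)
Lemma edge_cut v w y : e v w -> avoid v w y -> avoid w v y -> False.
Proof.
move=> vw wy vy; have wv : w != v by rewrite eq_sym edge_neq.
have yv := avoid_neq wv wy; have yw : y != w by apply: avoid_neq vy; rewrite eq_sym.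
have [p] := avoidP (edge_neq vw) vy; case: p => [_ [_ _ /= vE]|z p].
  by rewrite vE eqxx in yv.
move=> /= /andP[vz pth] [/andP[vp _] wp lst].
have zy : avoid v z y by rewrite -lst; apply: avoid_path.
have zw : z = w.
  by apply: (branch_unique vz vw); apply: avoid_trans zy _; rewrite avoid_sym.
by move: wp; rewrite zw !inE eqxx orbT.
Qed.

Lemma end_avoid m u w : (forall z z', e m z -> e m z' -> z = z') ->
  u != m -> w != m -> avoid m u w.
Proof.
move=> endm /branch_exists[z mz zu] /branch_exists[z' mz' z'w].
by rewrite -(endm _ _ mz mz') in z'w; apply: avoid_trans z'w; rewrite avoid_sym.
Qed.

(** The neighbour [m] of [u] towards [w] separates [u] from [w] unless it is
    [w] itself. *)
Lemma edge_of_avoid u w : u != w ->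
  (forall m, m != u -> m != w -> avoid m u w) -> e u w.
Proof.
move=> uw h; have [m um mw] : exists2 m, e u m & avoid u m w.
  by apply: branch_exists; rewrite eq_sym.
have [<-//|mw'] := eqVneq m w.
have mu : m != u by rewrite eq_sym edge_neq.
by case: (edge_cut um mw (h m mu mw')).
Qed.

(** Branches shrink along an edge that points into them; this is the measure
    for the two descents below. *)
Lemma card_avoid_edge v w y : e v w -> avoid v w y -> w != y ->
  #|[set u | avoid w y u]| < #|[set u | avoid v y u]|.
Proof.
move=> vw wy w'y; apply: proper_card; apply/fintype.properP; split.
  apply/fintype.subsetP => u; rewrite !inE => yu.
  case/orP: (avoid_or u (edge_neq vw)) => h.
    apply: avoid_trans (_ : avoid v w u); first by rewrite avoid_sym.
    by rewrite avoid_sym.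
  by case: (edge_cut vw wy); rewrite avoid_sym; exact: avoid_trans yu h.
by exists w; rewrite inE 1?avoid_sym // avoid_sym avoid_self // eq_sym.
Qed.

Variable leaf : pred V.
Hypothesis leafE : forall m, leaf m -> forall z z', e m z -> e m z' -> z = z'.
Hypothesis interE : forall m v, ~~ leaf m -> exists2 w, e m w & w != v.

(** Following edges away from [v], the remaining branch shrinks until a leaf is
    reached. *)
Lemma leaf_beyond v w : e v w -> exists2 x, leaf x & avoid v w x.
Proof.
have [n] := ubnP #|[set u | avoid v w u]|; elim: n v w => // n IHn v w cn vw.
have [wl|wi] := boolP (leaf w); first by exists w => //; exact: avoid_refl.
have [w' ww' w'v] := interE v wi.
have wv : w != v by rewrite eq_sym edge_neq.
have vww' : avoid v w w' by exact: avoid_edge.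
have sameC : #|[set u | avoid v w u]| = #|[set u | avoid v w' u]|.
  apply: eq_card => u; rewrite !inE; apply/idP/idP; apply: avoid_trans => //.
  by rewrite avoid_sym.
have [x xl xw'] : exists2 x, leaf x & avoid w w' x.
  apply: (IHn w w' _ ww'); rewrite -ltnS; apply: leq_trans cn; rewrite ltnS sameC.
  exact: card_avoid_edge vw vww' (edge_neq ww').
exists x => //; case/orP: (avoid_or x (edge_neq vw)) => h.
  by rewrite avoid_sym.
case/eqP: w'v; apply: (branch_unique ww'); first by rewrite esym.
exact: avoid_trans xw' h.
Qed.

Lemma leaf_avoid m u w : leaf m -> u != m -> w != m -> avoid m u w.
Proof. by move=> ml; apply: end_avoid; exact: leafE. Qed.

(** Start from the neighbour of [x] and, as long as [y] and [z] are in the same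
    branch, move one step towards them.  The branch containing [y] and [z]
    shrinks, and [x] stays behind in another one, so the walk stops at a vertex
    where the three leaves are in different branches. *)
Lemma median_exists x y z : leaf x -> leaf y -> leaf z ->
  x != y -> x != z -> y != z ->
  exists m, [/\ ~~ leaf m, ~~ avoid m x y, ~~ avoid m x z & ~~ avoid m y z].
Proof.
move=> xl yl zl xy xz yz.
have nl m : ~~ avoid m x y -> ~~ avoid m x z -> ~~ avoid m y z -> ~~ leaf m.
  move=> nxy nxz nyz; apply/negP => ml.
  have [mx|mx] := eqVneq m x.
    by case/negP: nyz; apply: leaf_avoid; rewrite // mx eq_sym.
  have [my|my] := eqVneq m y.
    by case/negP: nxz; apply: leaf_avoid; rewrite // my // eq_sym.
  by case/negP: nxy; apply: leaf_avoid; rewrite // eq_sym.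
have descend v : v != x -> v != y -> ~~ avoid v x y -> avoid v y z ->
    exists m, [/\ ~~ avoid m x y, ~~ avoid m x z & ~~ avoid m y z].
  have [n] := ubnP #|[set u | avoid v y u]|; elim: n v => // n IHn v cn vx vy nxy yzv.
  have [w vw wy] : exists2 w, e v w & avoid v w y.
    by apply: branch_exists; rewrite eq_sym.
  have vw' := edge_neq vw; have zv : z != v.
    by apply: avoid_neq yzv; rewrite eq_sym.
  have w'y : w != y.
    apply/eqP => wE; rewrite wE in vw.
    by apply: (edge_cut vw yzv); apply: leaf_avoid; rewrite // eq_sym.
  have wz : avoid v w z by exact: avoid_trans yzv.
  have w'z : w != z.
    apply/eqP => wE; rewrite wE in vw.
    apply: (edge_cut vw (_ : avoid v z y)); first by rewrite avoid_sym.
    by apply: leaf_avoid; rewrite // eq_sym.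
  have w'x : w != x.
    apply: contraNneq nxy => <-; exact: wy.
  have xv : avoid w x v.
    case/orP: (avoid_or x vw') => // h; case/negP: nxy.
    exact: avoid_trans h wy.
  have nxy' : ~~ avoid w x y.
    apply/negP => h; apply: (edge_cut vw wy).
    by apply: avoid_trans h; rewrite avoid_sym.
  have nxz' : ~~ avoid w x z.
    apply/negP => h; apply: (edge_cut vw wz).
    by apply: avoid_trans h; rewrite avoid_sym.
  have [yz'|] := boolP (avoid w y z); last by exists w.
  apply: (IHn w) => //.
  by rewrite -ltnS; apply: leq_trans cn; rewrite ltnS; exact: card_avoid_edge.
suff [m [nxy nxz nyz]] : exists m, [/\ ~~ avoid m x y, ~~ avoid m x z & ~~ avoid m y z].
  by exists m; split=> //; exact: nl.
have [v xv vy] : exists2 v, e x v & avoid x v y by apply: branch_exists; rewrite eq_sym.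
have vx : v != x by rewrite eq_sym edge_neq.
have vz : avoid x v z by apply: leaf_avoid; rewrite // eq_sym.
have xyv : ~~ avoid v x y by apply/negP; exact: edge_cut xv vy.
have xzv : ~~ avoid v x z by apply/negP; exact: edge_cut xv vz.
have [yzv|] := boolP (avoid v y z); last by exists v.
apply: (descend v) => //; apply: contraNneq xzv => vE.
by rewrite vE; apply: leaf_avoid => //; rewrite eq_sym.
Qed.

End TreeGraph.

(** * The tree defined by a system of directions *)

Section Directions.
(* [d v u] is the direction of [u] seen from the internal vertex [v], for [u]
   other than [inr v]. *)
Variables (E : finType) (n : nat) (S : eqType) (d : 'I_n -> E + 'I_n -> S).
Local Notation V := (E + 'I_n)%type.
Implicit Types (u w : V) (v m : 'I_n) (x y z : E).

(** The vertex [m] lies strictly between [u] and [w]. *)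
Definition dsep m u w := [&& inr m != u, inr m != w & d m u != d m w].

Definition dadj u w := (u != w) && [forall m, ~~ dsep m u w].

Hypothesis dir_or : forall v m u, v != m -> u != inr v -> u != inr m ->
  (d v u == d v (inr m)) || (d m u == d m (inr v)).
Hypothesis dir_three : forall v, exists x y z,
  [/\ d v (inl x) != d v (inl y), d v (inl x) != d v (inl z)
    & d v (inl y) != d v (inl z)].
Hypothesis dir_median : forall x y z, x != y -> x != z -> y != z ->
  exists v, [/\ d v (inl x) != d v (inl y), d v (inl x) != d v (inl z)
    & d v (inl y) != d v (inl z)].
Hypothesis E3 : 2 < #|E|.

Lemma dsep_sym m u w : dsep m u w = dsep m w u.
Proof. by rewrite /dsep [d m u == _]eq_sym andbCA. Qed.

Lemma dadj_sym : symmetric dadj.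
Proof.
move=> u w; rewrite /dadj eq_sym; congr (_ && _).
by apply: eq_forallb => m; rewrite dsep_sym.
Qed.

Lemma dadj_irr : irreflexive dadj.
Proof. by move=> u; rewrite /dadj eqxx. Qed.

Lemma dadj_neq u w : dadj u w -> u != w.
Proof. by case/andP. Qed.

Lemma dadj_dir m u w : dadj u w -> inr m != u -> inr m != w -> d m u = d m w.
Proof.
case/andP=> _ /forallP/(_ m); rewrite /dsep => /[swap] -> /[swap] -> /=.
by rewrite negbK => /eqP.
Qed.

(** If [v] is between [u] and [w], a vertex between [u] and [v] is between [u]
    and [w].  Since [v] itself is not between [u] and [v], the number of
    separating vertices drops, which is the induction in [connect_dadj]. *)
Lemma dsep_trans m v u w : dsep v u w -> dsep m u (inr v) -> dsep m u w.
Proof.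
case/and3P=> vu vw dvuw /and3P[mu mv dmuv].
have {}mv : v != m by apply: contraNneq mv => ->.
have dvu : d v u = d v (inr m).
  by have := dir_or mv; move=> /(_ u); rewrite eq_sym vu eq_sym mu (negbTE dmuv) orbF
    => /(_ isT isT)/eqP.
have mw : inr m != w by apply: contraNneq dvuw => <-; rewrite dvu.
apply/and3P; split=> //.
have := dir_or mv; move=> /(_ w); rewrite eq_sym vw eq_sym mw => /(_ isT isT).
by rewrite -dvu eq_sym (negbTE dvuw) /= => /eqP->.
Qed.

(** The set [A] is everything for connectedness, and all the vertices seen in
    one direction from a given vertex for the identification of the branches. *)
Lemma connect_dadj (A : pred V) u w : A u -> A w ->
  (forall u w m, A u -> A w -> dsep m u w -> A (inr m)) ->
  connect [rel a b | [&& dadj a b, A a & A b]] u w.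
Proof.
move=> + + hA; have [k] := ubnP #|[set m | dsep m u w]|.
elim: k u w => // k IHk u w ck Au Aw.
have [->|uw] := eqVneq u w; first exact: connect0.
have [/existsP[v vuw]|/existsPn nsep] := boolP [exists m, dsep m u w]; last first.
  by apply: connect1; rewrite /= Au Aw /dadj uw /= andbT; apply/forallP.
have Av := hA _ _ _ Au Aw vuw.
have sub u' w' : dsep v u' w' -> [set m | dsep m u' w'] = [set m | dsep m u w] ->
    #|[set m | dsep m u' (inr v)]| < k.
  move=> vu'w' e; rewrite -ltnS; apply: leq_trans ck; rewrite ltnS -e.
  apply: proper_card; apply/fintype.properP; split.
    by apply/fintype.subsetP => m; rewrite !inE; exact: dsep_trans.
  by exists v; rewrite !inE // /dsep eqxx andbF.
apply: connect_trans (IHk _ _ (sub _ _ vuw (erefl _)) Au Av) _.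
apply: IHk => //.
have -> : [set m | dsep m (inr v) w] = [set m | dsep m w (inr v)].
  by apply/setP => m; rewrite !inE dsep_sym.
apply: (sub w u); first by rewrite dsep_sym.
by apply/setP => m; rewrite !inE dsep_sym.
Qed.

Lemma dadj_connected u w : connect dadj u w.
Proof.
have := @connect_dadj predT u w isT isT (fun _ _ _ _ _ _ => isT).
by apply: connect_sub => a b /and3P[ab _ _]; exact: connect1.
Qed.

Lemma avoid_dadj v u w : u != inr v -> w != inr v ->
  avoid dadj (inr v) u w = (d v u == d v w).
Proof.
move=> uv wv; apply/idP/eqP => [/(avoidP uv)[p]|duw].
  elim: p u uv => [u _ _ [_ _ <-] //|a p IHp u uv /= /andP[ua pth]].
  case=> /andP[_ unq]; rewrite !inE !negb_or => /and3P[vu va vp] lst.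
  rewrite (dadj_dir ua) //; apply: IHp => //; first by rewrite eq_sym.
  by split=> //; rewrite inE negb_or va.
pose A := [pred a | (a != inr v) && (d v a == d v w)].
have := @connect_dadj A u w; rewrite !inE /= uv wv duw eqxx => /(_ isT isT).
move=> h; apply: connect_sub (h _) => [a b|a b m].
  rewrite /= => /and3P[ab /andP[av _] /andP[bv _]].
  by apply: connect1; rewrite /= ab av.
rewrite /= => /andP[av /eqP dva] /andP[bv /eqP dvb] /and3P[ma mb dmab].
have mv : v != m.
  by apply: contraNneq dmab => <-; rewrite dva dvb.
have -> : inr m != inr v :> V by apply: contraNneq mv => -[->].
have [//|dvm] := eqVneq (d v (inr m)) (d v w).
have : d m a == d m (inr v).
  by have := dir_or mv av; rewrite eq_sym ma dva eq_sym (negbTE dvm); apply.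
have : d m b == d m (inr v).
  by have := dir_or mv bv; rewrite eq_sym mb dvb eq_sym (negbTE dvm); apply.
by move=> /eqP mbv /eqP mav; rewrite mbv mav eqxx in dmab.
Qed.

(** The leaf [x] is beyond [u] when looking from [w]. *)
Definition far u w x : bool :=
  match u with inl y => x == y | inr u' => d u' (inl x) != d u' w end.

Lemma far_exists u w : exists x, far u w x.
Proof.
case: u => [y|u] /=; first by exists y.
have [x [y [_ [xy _ _]]]] := dir_three u.
have [xw|xw] := eqVneq (d u (inl x)) (d u w); last by exists x.
by exists y; rewrite -xw eq_sym.
Qed.

Lemma far_dir m w x : inr m != w -> far w (inr m) x -> d m (inl x) = d m w.
Proof.
case: w => [y _ /= /eqP -> //|v] mv /= dvx.
have vm : v != m by apply: contraNneq mv => ->.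
by have := dir_or vm (u := inl x) isT isT; rewrite (negbTE dvx) => /eqP.
Qed.

Lemma far_neq u w x y : u != w -> far u w x -> far w u y -> x != y.
Proof.
case: u w => [x'|u] [y'|w] uw /=.
- by move=> /eqP -> /eqP ->; apply: contraNneq uw => ->.
- by move=> /eqP ->; rewrite eq_sym; apply: contraNneq => ->.
- by move=> + /eqP ->; apply: contraNneq => ->.
- move=> ux wy; apply: contraNneq ux => ->; apply/eqP.
  exact: (far_dir (w := inr w)).
Qed.

(** Seen from a third vertex [m], a leaf beyond [u] and a leaf beyond [w] cannot
    both be seen in another direction than [u] and [w] respectively: otherwise
    [m] would be beyond [u] and beyond [w] at the same time. *)
Lemma far_between u w x y m : u != w -> inr m != u -> inr m != w ->
  far u w x -> far w u y -> d m (inl x) = d m u \/ d m (inl y) = d m w.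
Proof.
case: u => [x'|u]; first by move=> _ _ _ /eqP -> _; left.
case: w => [y'|w]; first by move=> _ _ _ _ /eqP ->; right.
move=> uw mu mw /= ux wy.
have u_w : u != w by apply: contraNneq uw => ->.
have u_m : u != m by apply: contraNneq mu => ->.
have w_m : w != m by apply: contraNneq mw => ->.
have := dir_or u_m (u := inl x) isT isT; case/orP => /eqP eu; last by left.
have := dir_or w_m (u := inl y) isT isT; case/orP => /eqP ew; last by right.
have := dir_or u_w mu mw; rewrite -eu -ew (negbTE ux) => /eqP e.
by rewrite e eqxx in wy.
Qed.

(** Choose leaves [x], [y], [z] beyond [u], [w1], [w2].  If [w1] and [w2] are
    distinct and, in case [u] is internal, in the same direction from it, the
    vertex [m] that separates these leaves is none of [u], [w1], [w2].  By
    adjacency it sees the three of them in one direction, hence, by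
    [far_between], at least two of the three leaves too: a contradiction. *)
Lemma dadj_inj u w1 w2 : dadj u w1 -> dadj u w2 ->
  (forall v, u = inr v -> d v w1 = d v w2) -> w1 = w2.
Proof.
move=> uw1 uw2 du; apply/eqP; apply: contraT => w12.
have u1 := dadj_neq uw1; have u2 := dadj_neq uw2.
have [x ux1] := far_exists u w1; have [y wy1] := far_exists w1 u.
have [z wz1] := far_exists w2 u.
have ux2 : far u w2 x.
  move: ux1; rewrite /far.
  by case: u {uw1 uw2 u1 u2 wy1 wz1} du => // v /(_ v (erefl _)) ->.
have wy2 : far w1 w2 y.
  move: wy1; rewrite /far; case: (w1) u1 w12 => // m mu mw.
  by rewrite (dadj_dir uw2) // eq_sym.
have wz2 : far w2 w1 z.
  move: wz1; rewrite /far; case: (w2) u2 w12 => // m mu mw.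
  by rewrite (dadj_dir uw1) // eq_sym.
have xy : x != y by apply: far_neq ux1 wy1.
have xz : x != z by apply: far_neq ux2 wz1.
have yz : y != z by apply: far_neq wy2 wz2.
have [m [mxy mxz myz]] := dir_median xy xz yz.
have mu : inr m != u.
  apply/eqP => mE; case/eqP: myz; rewrite -mE in u1 u2 wy1 wz1.
  by rewrite (far_dir u1) // (far_dir u2) //; apply: du.
have m1 : inr m != w1.
  apply/eqP => mE; case/eqP: mxz; rewrite -mE in u1 ux1 w12 wz2.
  rewrite (@far_dir _ u) // 1?eq_sym // (far_dir w12) //.
  by apply: dadj_dir => //; rewrite eq_sym.
have m2 : inr m != w2.
  apply/eqP => mE; case/eqP: mxy; rewrite -mE in u2 ux2 w12 wy2.
  rewrite (@far_dir _ u) // 1?eq_sym // (@far_dir _ w1) // 1?eq_sym //.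
  by apply: dadj_dir => //; rewrite eq_sym.
have e1 := dadj_dir uw1 mu m1; have e2 := dadj_dir uw2 mu m2.
have := far_between u1 mu m1 ux1 wy1; have := far_between u2 mu m2 ux2 wz1.
have := far_between w12 m1 m2 wy2 wz2; rewrite -e1 -e2.
move=> [] h1 [] h2 [] h3; move: mxy mxz myz; rewrite ?h1 ?h2 ?h3 ?eqxx //.
Qed.

(** In a cycle through [u], the two neighbours of [u] are joined by a path that
    avoids [u], so they are in the same direction and [dadj_inj] applies. *)
Lemma dadj_acyclic c : ucycle dadj c -> size c <= 2.
Proof.
case: c => [|u [|w1 p]] //; case/lastP: p => [|p w2] //= /andP[].
rewrite [cycle _ _]/= rcons_path last_rcons => /andP[uw1 /andP[pth w2u]].
move=> unq.
suff w12 : w1 = w2 by move: unq; rewrite w12 /= mem_rcons inE eqxx !andbF.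
apply: (dadj_inj uw1); first by rewrite dadj_sym.
move=> v uE; rewrite uE in uw1 w2u unq.
apply/eqP; rewrite -avoid_dadj; last by exact: dadj_neq.
  rewrite -[w2 in avoid _ _ _ w2](last_rcons w1 p).
  by apply: avoid_path => //; case/andP: unq.
by rewrite eq_sym dadj_neq.
Qed.

Lemma dadj_leaf x : #|[set w | dadj (inl x) w]| = 1.
Proof.
have [y yx] : exists y, y != x.
  have [y yx _] : exists2 y, y \notin [set x] & y \in E.
    have : ~~ (E \subset [set x]).
      apply: contraL E3 => /subset_leq_card; rewrite cards1 -leqNgt => h.
      exact: leq_trans h _.
    by case/fintype.subsetPn => y yE yx; exists y.
  by exists y; rewrite inE in yx.
have [w xw _] : exists2 w, dadj (inl x) w & avoid dadj (inl x) w (inl y).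
  by apply: branch_exists; [exact: dadj_connected | apply: contraNneq yx => -[->]].
apply/eqP/cards1P; exists w; apply/setP => w'; rewrite !inE.
apply/idP/eqP => [xw'|-> //].
by apply: (dadj_inj xw' xw).
Qed.

Lemma dadj_int v : 3 <= #|[set w | dadj (inr v) w]|.
Proof.
have [x [y [z [xy xz yz]]]] := dir_three v.
have br a : exists w, dadj (inr v) w /\ d v w = d v (inl a).
  have [w vw wa] : exists2 w, dadj (inr v) w & avoid dadj (inr v) w (inl a).
    by apply: branch_exists => //; exact: dadj_connected.
  exists w; split => //; apply/eqP; rewrite -avoid_dadj // eq_sym.
  exact: dadj_neq.
have [wx [vx ex]] := br x; have [wy [vy ey]] := br y; have [wz [vz ez]] := br z.
rewrite -ex -ey -ez in xy xz yz.
have uw : uniq [:: wx; wy; wz].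
  rewrite /= !inE negb_or andbT -andbA; apply/and3P; split.
  - by apply: contraNneq xy => ->.
  - by apply: contraNneq xz => ->.
  - by apply: contraNneq yz => ->.
have <- : #|[:: wx; wy; wz]| = 3 by apply/card_uniqP.
apply: subset_leq_card; apply/fintype.subsetP => w.
by rewrite !inE => /or3P[] /eqP->.
Qed.

Definition dir_tree : combTree E :=
  CombTree dadj_sym dadj_irr dadj_connected dadj_acyclic dadj_leaf dadj_int.

End Directions.

(** * Directions determined by the leaves *)

Section LeafDirections.
Variables (E : finType) (n : nat) (S : eqType) (s0 : S) (A : 'I_n -> E -> S).
Implicit Types (v m a : 'I_n) (x y z : E).

Hypothesis leaf_or : forall v m, v != m ->
  exists p q, forall x, A v x = p \/ A m x = q.
Hypothesis leaf_three : forall v, exists x y z,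
  [/\ A v x != A v y, A v x != A v z & A v y != A v z].

(** The direction of [m] seen from [v] is the only one in which [v] sees two
    leaves that [m] sees in different directions. *)
Definition dirs v (u : E + 'I_n) : S :=
  match u with
  | inl x => A v x
  | inr m =>
    if [pick xy : E * E | (A m xy.1 != A m xy.2) && (A v xy.1 == A v xy.2)]
    is Some xy then A v xy.1 else s0
  end.

Lemma two_away v p : exists x y, [/\ A v x != A v y, A v x != p & A v y != p].
Proof.
have [x [y [z [xy xz yz]]]] := leaf_three v.
have [xp|xp] := eqVneq (A v x) p.
  by exists y, z; rewrite yz -xp eq_sym xy eq_sym xz.
have [yp|yp] := eqVneq (A v y) p; last by exists x, y.
by exists x, z; rewrite xz xp -yp eq_sym yz.
Qed.

Lemma dirs_other v m : v != m ->
  exists p, forall x, A m x = p \/ A v x = dirs v (inr m).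
Proof.
move=> vm; have [q [p h]] := leaf_or vm; exists p => x.
suff -> : dirs v (inr m) = q by case: (h x); [right|left].
rewrite /dirs; case: pickP => [[y z] /= /andP[yz /eqP e]|none].
  case: (h y) => // my; case: (h z) => // mz; first by rewrite e.
  by rewrite my mz eqxx in yz.
have [y [z [yz yp zp]]] := two_away m p.
have [//|/eqP] := h y; last by rewrite (negbTE yp).
have [|/eqP] := h z; last by rewrite (negbTE zp).
by move=> e1 e2; have := none (y, z); rewrite /= yz e1 e2 eqxx.
Qed.

Lemma dirs_inr v m x y : v != m -> A m x != A m y -> A v x = A v y ->
  dirs v (inr m) = A v x.
Proof.
move=> vm mxy e; have [p h] := dirs_other vm.
have [mx|<- //] := h x; have [my|] := h y; last by rewrite e.
by rewrite mx my eqxx in mxy.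
Qed.

(** For a third internal vertex [a] not in the direction of [v] seen from [m],
    the leaves beyond [a] witness that [v] sees [a] and [m] in the same
    direction. *)
Lemma dirs_or v m (u : E + 'I_n) : v != m -> u != inr v -> u != inr m ->
  (dirs v u == dirs v (inr m)) || (dirs m u == dirs m (inr v)).
Proof.
have leaf w k x : w != k ->
    A w x = dirs w (inr k) \/ A k x = dirs k (inr w).
  move=> wk; have [p h] := dirs_other wk.
  have [e|] := h x; last by left.
  right; rewrite e; have [y [z [yz yp zp]]] := two_away w (dirs w (inr k)).
  have [ey|/eqP] := h y; last by rewrite (negbTE yp).
  have [ez|/eqP] := h z; last by rewrite (negbTE zp).
  by rewrite (dirs_inr (x := y) (y := z)) ?ey ?ez // eq_sym.
move=> vm; case: u => [x _ _|a av am].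
  by apply/orP; case: (leaf _ _ x vm) => e; [left|right]; apply/eqP.
have {}av : v != a by apply: contraNneq av => ->.
have {}am : m != a by apply: contraNneq am => ->.
have [//|nm] := eqVneq (dirs m (inr a)) (dirs m (inr v)); first by rewrite orbT.
have [p hp] := dirs_other am.
have [x [y [xy xp yp]]] := two_away a p.
have [/eqP|mx] := hp x; first by rewrite (negbTE xp).
have [/eqP|my] := hp y; first by rewrite (negbTE yp).
have [vx|e] := leaf _ _ x vm; last by rewrite -mx e eqxx in nm.
have [vy|e] := leaf _ _ y vm; last by rewrite -my e eqxx in nm.
by rewrite (dirs_inr av xy) ?vx ?vy ?eqxx.
Qed.

End LeafDirections.

Section DirectionsRigid.
Variables (E : finType) (n1 n2 : nat) (S : eqType).
(* Two systems of directions whose values at the leaves correspond under [f]; the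
   values at the internal vertices then correspond too. *)
Variables (d1 : 'I_n1 -> E + 'I_n1 -> S) (d2 : 'I_n2 -> E + 'I_n2 -> S).
Hypothesis dir1_or : forall v m u, v != m -> u != inr v -> u != inr m ->
  (d1 v u == d1 v (inr m)) || (d1 m u == d1 m (inr v)).
Hypothesis dir1_three : forall v, exists x y z,
  [/\ d1 v (inl x) != d1 v (inl y), d1 v (inl x) != d1 v (inl z)
    & d1 v (inl y) != d1 v (inl z)].
Hypothesis dir2_or : forall v m u, v != m -> u != inr v -> u != inr m ->
  (d2 v u == d2 v (inr m)) || (d2 m u == d2 m (inr v)).
Variables (mu : 'I_n1 -> 'I_n2) (f : 'I_n1 -> S -> S).
Hypothesis mu_bij : bijective mu.
Hypothesis f_inj : forall v, injective (f v).
Hypothesis d12 : forall v x, d2 (mu v) (inl x) = f v (d1 v (inl x)).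

(** The direction of [a] seen from [v] is read off two leaves beyond [a]. *)
Lemma dirs_map v u : u != inr v -> d2 (mu v) (extv mu u) = f v (d1 v u).
Proof.
case: u => [x _|a av] /=; first exact: d12.
have va : v != a by apply: contraNneq av => ->.
have va2 : mu v != mu a by rewrite (inj_eq (bij_inj mu_bij)).
have [x [y [xy xp yp]]] :=
  two_away (A := fun v x => d1 v (inl x)) dir1_three a (d1 a (inr v)).
have dvx : d1 v (inl x) = d1 v (inr a).
  by have := dir1_or va (u := inl x) isT isT; rewrite (negbTE xp) orbF => /eqP.
have dvy : d1 v (inl y) = d1 v (inr a).
  by have := dir1_or va (u := inl y) isT isT; rewrite (negbTE yp) orbF => /eqP.
rewrite -dvx -d12.
have := dir2_or va2 (u := inl x) isT isT; case: eqP => [<- //|_ /= /eqP ex].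
have := dir2_or va2 (u := inl y) isT isT; case: eqP => [<- _|_ /= /eqP ey].
  by rewrite !d12 dvx dvy.
by move: ex; rewrite -ey !d12 => /f_inj e; rewrite e eqxx in xy.
Qed.

Lemma dadj_map u w : dadj d2 (extv mu u) (extv mu w) = dadj d1 u w.
Proof.
have mu_inj := bij_inj mu_bij.
have ext_inj : injective (extv mu : E + 'I_n1 -> E + 'I_n2).
  by move=> [x|v] [y|m] //= [] => [->|/mu_inj ->].
rewrite /dadj (inj_eq ext_inj); congr (_ && _).
have sepE m : dsep d2 (mu m) (extv mu u) (extv mu w) = dsep d1 m u w.
  rewrite /dsep -[inr (mu m)]/(extv mu (inr m)) !(inj_eq ext_inj).
  have [//|mu_] := eqVneq (inr m) u.
  have [//|mw] := eqVneq (inr m) w.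
  by rewrite (dirs_map (u := u)) 1?eq_sym // (dirs_map (u := w)) 1?eq_sym //
    (inj_eq (@f_inj m)) eq_sym.
have [nu nuK muK] := mu_bij.
apply/idP/idP => /forallP h; apply/forallP => m; first by rewrite -sepE.
by rewrite -(muK m) sepE.
Qed.

End DirectionsRigid.

Local Open Scope classical_set_scope.
Local Open Scope ring_scope.
Local Open Scope quotient_scope.

(** * Topology of the Riemann sphere *)

Section SphereTopology.
Variable R : realType.
Local Notation C := (Cplx R).
Local Notation S := (sphere R).

Definition of_pair (p : R * R) : C := Complex p.1 p.2.

(** The order and the norm of the complex numbers have complex values, so a
    radius has to be replaced by its real part before it can be halved
    coordinatewise. *)
Lemma of_pair_continuous : continuous of_pair.
Proof.
move=> p; apply/cvgrPdist_lt => e e0.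
have eE : e = (complex.Re e)%:C%C by rewrite RRe_real // gtr0_real.
have r0 : 0 < complex.Re e / 2 :> R.
  by rewrite divr_gt0 //; move: e0; rewrite eE ltcR.
have n1 : \forall q \near p, `|p.1 - q.1| < complex.Re e / 2.
  have c : (fun q : R * R => q.1) @ p --> p.1 by exact: cvg_fst.
  exact: (proj1 (cvgrPdist_lt _ _) c _ r0).
have n2 : \forall q \near p, `|p.2 - q.2| < complex.Re e / 2.
  have c : (fun q : R * R => q.2) @ p --> p.2 by exact: cvg_snd.
  exact: (proj1 (cvgrPdist_lt _ _) c _ r0).
near=> q.
have Dq : of_pair p - of_pair q =
    (p.1 - q.1)%:C%C + (p.2 - q.2)%:C%C * 'i%C :> R[i].
  by rewrite /of_pair; simpc.
rewrite Dq (le_lt_trans (ler_normD _ _)) // normrM.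
have -> : `|('i%C : R[i])| = 1 by rewrite normc_def /= expr0n expr1n add0r sqrtr1.
have nE (x : R) : `|x%:C%C : R[i]| = (`|x|)%:C%C.
  by rewrite normc_def /= expr0n addr0 sqrtr_sqr.
rewrite mulr1 !nE -rmorphD /= [ltRHS]eE ltcR (splitr (complex.Re e)) ltrD //.
- by near: q.
- by near: q.
Unshelve. all: by end_near. Qed.

Lemma Cplx_hausdorff : hausdorff_space C.
Proof. exact: norm_hausdorff. Qed.

Definition disc (r : C) : set C := [set z | `|z| <= r].

Lemma disc_closed (r : C) : r \is Num.real -> closed (disc r).
Proof.
move=> rR z clz; rewrite /disc /=.
rewrite real_leNgt ?normr_real //; apply/negP => rz.
have /cvgr_dist_lt/(_ (`|z| - r)) : (fun w : C => w) @ z --> z := cvg_id.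
rewrite subr_gt0 => /(_ rz) /clz [w [/= wr]].
move=> /(le_lt_trans (lerB_dist z w)); rewrite ltrD2l ltrN2.
by move=> /lt_le_trans /(_ wr); rewrite ltxx.
Qed.

(** The disc is a closed part of the image of a square of the real plane. *)
Lemma disc_compact (r : C) : r \is Num.real -> compact (disc r).
Proof.
move=> r0; pose I := `[- complex.Re r, complex.Re r]%classic.
apply: (subclosed_compact (B := of_pair @` (I `*` I))).
- exact: disc_closed r0.
- apply: continuous_compact; last by apply: compact_setX; apply: segment_compact.
  exact/continuous_subspaceT/of_pair_continuous.
- case=> a b /= zr; exists (a, b) => //.
  have ar : `|a| <= complex.Re r.
    rewrite -lecR (RRe_real r0); apply: le_trans zr.
    exact: (normc_ge_Re (Complex a b)).
  have br : `|b| <= complex.Re r.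
    rewrite -lecR (RRe_real r0); apply: le_trans zr.
    have := normc_ge_Re (Complex b a); rewrite !normc_def /=.
    by rewrite addrC.
  by split => /=; rewrite /I /= in_itv /= -ler_norml.
Qed.

Lemma Cplx_locally_compact : locally_compact [set: C].
Proof.
move=> z _; rewrite withinET; exists (disc (`|z| + 1)).
  have /cvgr_dist_lt/(_ 1 ltr01) : (fun w : C => w) @ z --> z := cvg_id.
  apply: filterS => w zw; rewrite /disc /=.
  rewrite -[w](subrK z) addrC (le_trans (ler_normD _ _)) // lerD2l.
  by rewrite distrC ltW.
have r0 : `|z| + 1 \is Num.real by rewrite realD ?normr_real ?real1.
by split; [exact: disc_compact|exact: disc_closed].
Qed.

Lemma sphere_hausdorff : hausdorff_space S.
Proof.
apply: one_point_compactification_hausdorff.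
  exact: Cplx_locally_compact.
exact: Cplx_hausdorff.
Qed.

Lemma sphere_compact : compact [set: S].
Proof. exact: one_point_compactification_compact. Qed.

End SphereTopology.

(** * Cross-ratios *)

Section CrossRatio.
Variable R : realType.
Local Notation C := (Cplx R).
Local Notation S := (sphere R).
Implicit Types (a b z : S) (f : S -> S).

(** Homogeneous coordinates: [z] is the point [hnum z : hden z]. *)
Definition hnum z : C := if z is Some x then x else 1.
Definition hden z : C := if z is Some _ then 1 else 0.

Lemma hnum_hden_neq0 z : (hnum z != 0) || (hden z != 0).
Proof. by case: z => [x|]; rewrite /= oner_neq0 ?orbT. Qed.

Lemma hpoint_num_den z : hpoint (hnum z) (hden z) = z.
Proof. by case: z => [x|]; rewrite /hpoint /= ?eqxx // oner_eq0 divr1. Qed.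

Lemma hpointP (x y : C) : (x != 0) || (y != 0) ->
  exists2 k : C, k != 0 & x = k * hnum (hpoint x y) /\ y = k * hden (hpoint x y).
Proof.
rewrite /hpoint; have [-> /=|y0 _] := eqVneq y 0.
  by rewrite orbF => x0; exists x => //; rewrite mulr1 mulr0.
by exists y => //=; rewrite mulr1 mulrCA divff ?mulr1.
Qed.

(** The determinant of the homogeneous coordinates, which replaces the difference
    of two points and stays meaningful at infinity. *)
Definition hdet a b : C := hnum a * hden b - hnum b * hden a.

Lemma hdet_eq0 a b : (hdet a b == 0) = (a == b).
Proof.
rewrite /hdet; case: a b => [a|] [b|] /=;
  rewrite ?(mulr1, mul1r, mulr0, mul0r, subr0, sub0r, oppr_eq0, oner_eq0, subrr, eqxx) //.
by rewrite subr_eq0.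
Qed.

Lemma hdetxx a : hdet a a = 0.
Proof. exact: subrr. Qed.

(** The equation of [z = cross a1 a2 a3 a4] with denominators cleared.  It is
    multihomogeneous of degree one in each point, and holds for all [z] when
    three of the points [a1], [a2], [a3], [a4] coincide. *)
Definition crossrel a1 a2 a3 a4 z : Prop :=
  hdet a4 a1 * hdet a2 a3 * hden z = hnum z * (hdet a4 a3 * hdet a2 a1).

Definition cross a1 a2 a3 a4 : S :=
  hpoint (hdet a4 a1 * hdet a2 a3) (hdet a4 a3 * hdet a2 a1).

Lemma mobius_num_den (a b c d : C) z :
  mobius a b c d z = hpoint (a * hnum z + b * hden z) (c * hnum z + d * hden z).
Proof. by rewrite -{1}(hpoint_num_den z) mobius_hpoint ?hnum_hden_neq0. Qed.

Lemma mobius_lift_neq0 (a b c d : C) z : a * d - b * c != 0 ->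
  (a * hnum z + b * hden z != 0) || (c * hnum z + d * hden z != 0).
Proof.
move=> D0; have := hnum_hden_neq0 z; rewrite -!negb_and; apply: contra.
move=> /andP[/eqP h1 /eqP h2].
have e1 : (a * d - b * c) * hnum z = 0.
  transitivity (d * (a * hnum z + b * hden z) - b * (c * hnum z + d * hden z)).
    by ring.
  by rewrite h1 h2 !mulr0 subr0.
have e2 : (a * d - b * c) * hden z = 0.
  transitivity (a * (c * hnum z + d * hden z) - c * (a * hnum z + b * hden z)).
    by ring.
  by rewrite h1 h2 !mulr0 subr0.
by move/eqP: e1; move/eqP: e2; rewrite !mulf_eq0 (negbTE D0) /= => -> ->.
Qed.

(** A projective map multiplies the determinants by that of its matrix, up to
    the rescaling [k] of the homogeneous coordinates. *)
Lemma projective_iso_hdet f : projective_iso f ->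
  exists2 D : C, D != 0 & exists2 k : S -> C, (forall z, k z != 0) &
    forall a b, k a * k b * hdet (f a) (f b) = D * hdet a b.
Proof.
move=> [a [b [c [d [D0 fE]]]]]; exists (a * d - b * c) => //.
have kP z : exists k : C, k != 0 /\
    a * hnum z + b * hden z = k * hnum (f z) /\ c * hnum z + d * hden z = k * hden (f z).
  have [k k0 kE] := hpointP (mobius_lift_neq0 z D0).
  by exists k; rewrite fE mobius_num_den.
have [k {}kP] := boolp.choice kP.
exists k => [z|x y]; first by case: (kP z).
have [_ [nx dx]] := kP x; have [_ [ny dy]] := kP y.
transitivity ((k x * hnum (f x)) * (k y * hden (f y)) -
  (k y * hnum (f y)) * (k x * hden (f x))); first by rewrite /hdet; ring.
by rewrite -nx -dx -ny -dy /hdet; ring.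
Qed.

Lemma projective_iso_inj f : projective_iso f -> injective f.
Proof. by move=> /projective_iso_inv[g _ fK]; exact: can_inj fK. Qed.

Lemma crossrel_proj f a1 a2 a3 a4 z : projective_iso f ->
  crossrel (f a1) (f a2) (f a3) (f a4) z <-> crossrel a1 a2 a3 a4 z.
Proof.
move=> /projective_iso_hdet[D D0 [k k0 kE]]; rewrite /crossrel.
pose K := k a1 * k a2 * k a3 * k a4.
have K0 : K != 0 by rewrite !mulf_neq0.
have DD0 : D * D != 0 by rewrite mulf_neq0.
have e1 : K * (hdet (f a4) (f a1) * hdet (f a2) (f a3) * hden z) =
    D * D * (hdet a4 a1 * hdet a2 a3 * hden z).
  transitivity ((k a4 * k a1 * hdet (f a4) (f a1)) *
    (k a2 * k a3 * hdet (f a2) (f a3)) * hden z); first by rewrite /K; ring.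
  by rewrite !kE; ring.
have e2 : K * (hnum z * (hdet (f a4) (f a3) * hdet (f a2) (f a1))) =
    D * D * (hnum z * (hdet a4 a3 * hdet a2 a1)).
  transitivity ((k a4 * k a3 * hdet (f a4) (f a3)) *
    (k a2 * k a1 * hdet (f a2) (f a1)) * hnum z); first by rewrite /K; ring.
  by rewrite !kE; ring.
split=> h.
  by apply: (mulfI DD0); rewrite -e1 -e2 h.
by apply: (mulfI K0); rewrite e1 e2 h.
Qed.

Lemma crossrel_normal a z : crossrel (Some 0) (Some 1) None a z <-> a = z.
Proof.
transitivity (hdet a z = 0); last first.
  by split=> [/eqP|->]; rewrite ?hdetxx // hdet_eq0 => /eqP.
rewrite /crossrel /hdet /=.
have -> : (hnum a * 1 - 0 * hden a) * (1 * 0 - 1 * 1) * hden z = - (hnum a * hden z).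
  by ring.
have -> : hnum z * ((hnum a * 0 - 1 * hden a) * (1 * 1 - 0 * 1)) = - (hnum z * hden a).
  by ring.
split=> [/oppr_inj ->|/eqP]; first by rewrite subrr.
by rewrite subr_eq0 => /eqP ->.
Qed.

(** The reason for the choice of [crossrel]: the normalized projective map
    sends [a] to the cross-ratio of [a1], [a2], [a3], [a]. *)
Lemma crossrel_normalized f a1 a2 a3 a z : projective_iso f ->
  f a1 = Some 0 -> f a2 = Some 1 -> f a3 = None ->
  crossrel a1 a2 a3 a z <-> f a = z.
Proof.
by move=> pf e1 e2 e3; rewrite -(crossrel_proj _ _ _ _ _ pf) e1 e2 e3 crossrel_normal.
Qed.

Lemma cross_proj a1 a2 a3 : a1 != a2 -> a1 != a3 -> a2 != a3 ->
  projective_iso (cross a1 a2 a3).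
Proof.
move=> a12 a13 a23.
exists (hden a1 * hdet a2 a3), (- hnum a1 * hdet a2 a3),
  (hden a3 * hdet a2 a1), (- hnum a3 * hdet a2 a1); split.
  have -> : hden a1 * hdet a2 a3 * (- hnum a3 * hdet a2 a1) -
     - hnum a1 * hdet a2 a3 * (hden a3 * hdet a2 a1) =
     hdet a2 a3 * hdet a2 a1 * hdet a1 a3 by rewrite /(hdet a1 a3); ring.
  by rewrite !mulf_neq0 // hdet_eq0 // eq_sym.
by move=> z; rewrite mobius_num_den /cross; congr hpoint; rewrite /hdet; ring.
Qed.

Lemma cross1 a1 a2 a3 : a1 != a2 -> a1 != a3 -> cross a1 a2 a3 a1 = Some 0.
Proof.
move=> a12 a13; rewrite /cross hdetxx mul0r /hpoint mulf_eq0 !hdet_eq0.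
by rewrite (negbTE a13) eq_sym (negbTE a12) mul0r.
Qed.

Lemma cross2 a1 a2 a3 : a1 != a2 -> a2 != a3 -> cross a1 a2 a3 a2 = Some 1.
Proof.
move=> a12 a23; rewrite /cross /hpoint mulf_eq0 !hdet_eq0.
rewrite (negbTE a23) eq_sym (negbTE a12) /= [X in X / _]mulrC divff //.
by rewrite mulf_neq0 // hdet_eq0 // eq_sym.
Qed.

Lemma cross3 a1 a2 a3 : cross a1 a2 a3 a3 = None.
Proof. by rewrite /cross hdetxx mul0r /hpoint eqxx. Qed.

Lemma crossrelP a1 a2 a3 a z : a1 != a2 -> a1 != a3 -> a2 != a3 ->
  crossrel a1 a2 a3 a z <-> cross a1 a2 a3 a = z.
Proof.
move=> a12 a13 a23; apply: crossrel_normalized.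
- exact: cross_proj.
- exact: cross1.
- exact: cross2.
- exact: cross3.
Qed.

(** The coordinates [hnum] and [hden] are discontinuous at infinity, but each
    point has continuous homogeneous coordinates nearby: near infinity, [1 : 1/x]
    replaces [x : 1]. *)
Lemma hnum_hden_local (a : S) : exists n d : S -> C,
  [/\ {for a, continuous n}, {for a, continuous d} &
    \forall b \near a, exists2 k : C, k != 0 & n b = k * hnum b /\ d b = k * hden b].
Proof.
case: a => [x|]; last first.
  pose d (z : S) : C := if z is Some x then x^-1 else 0.
  exists (fun=> 1), d; split.
  - by have /(_ (None : S)) := @cst_continuous S C 1.
  - suff : forall a : S, a = None -> {for a, continuous d} by apply.
    move=> a aN; have FN : Filter (one_point_nbhs a) by exact: (@nbhs_filter S a).
    apply/cvgrPdist_lt => e e0; rewrite {}aN.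
    (* outside this disc the inverse of x has modulus less than e *)
    exists (disc e^-1).
      have er : e^-1 \is Num.real by rewrite realV gtr0_real.
      by split; [exact: disc_compact | exact: disc_closed].
    move=> z [[x /= xe <-]|->] /=; last by rewrite subrr normr0.
    rewrite sub0r normrN normfV invf_plt ?posrE //.
      by rewrite real_ltNge ?normr_real // ?realV ?gtr0_real //; apply/negP.
    rewrite normr_gt0; apply/negP => /eqP x0; apply: xe.
    by rewrite /disc /= x0 normr0 invr_ge0 ltW.
  - exists (disc (1 : C)).
      by split; [apply: disc_compact|apply: disc_closed]; exact: real1.
    move=> z [[x /= xe <-]|->] /=; last first.
      by exists 1; rewrite ?oner_neq0 // !mul1r.
    have x0 : x != 0.
      by apply/negP => /eqP x0; apply: xe; rewrite /disc /= x0 normr0 ler01.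
    by exists x^-1; rewrite ?invr_eq0 // mulVf ?mulr1.
exists hnum, hden; split.
- move=> U /= Ux; exact: Ux.
- by have /(_ (Some x : S)) := @cst_continuous S C 1; move=> h U /h; rewrite /nbhs /=.
- by apply: filterE => b; exists 1; rewrite ?oner_neq0 // !mul1r.
Qed.

(** By homogeneity the relation can be tested on continuous local coordinates,
    where it is the vanishing of a continuous function. *)
Lemma closed_crossrel (X : topologicalType) (f1 f2 f3 f4 f5 : X -> S) :
  continuous f1 -> continuous f2 -> continuous f3 -> continuous f4 ->
  continuous f5 ->
  closed [set x | crossrel (f1 x) (f2 x) (f3 x) (f4 x) (f5 x)].
Proof.
move=> c1 c2 c3 c4 c5; rewrite -openC openE => x /= nx.
have lift (f : X -> S) : continuous f -> exists n d : X -> C,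
    [/\ n @ x --> n x, d @ x --> d x & \forall y \near x,
       exists2 k : C, k != 0 & n y = k * hnum (f y) /\ d y = k * hden (f y)].
  move=> cf; have [n [d [cn cd nd]]] := hnum_hden_local (f x).
  exists (n \o f), (d \o f); split.
  - exact: (continuous_comp (cf x) cn).
  - exact: (continuous_comp (cf x) cd).
  - exact: (cf x _ nd).
have [n1 [d1 [cn1 cd1 h1]]] := lift _ c1.
have [n2 [d2 [cn2 cd2 h2]]] := lift _ c2.
have [n3 [d3 [cn3 cd3 h3]]] := lift _ c3.
have [n4 [d4 [cn4 cd4 h4]]] := lift _ c4.
have [n5 [d5 [cn5 cd5 h5]]] := lift _ c5.
pose D (n d n' d' : X -> C) y : C := n y * d' y - n' y * d y.
have cD (n d n' d' : X -> C) : n @ x --> n x -> d @ x --> d x -> n' @ x --> n' x ->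
    d' @ x --> d' x -> D n d n' d' @ x --> D n d n' d' x.
  by move=> cn cd cn' cd'; exact: (cvgB (cvgM cn cd') (cvgM cn' cd)).
pose G y : C := D n4 d4 n1 d1 y * D n2 d2 n3 d3 y * d5 y -
  n5 y * (D n4 d4 n3 d3 y * D n2 d2 n1 d1 y).
have cG : G @ x --> G x.
  exact: (cvgB (cvgM (cvgM (cD _ _ _ _ cn4 cd4 cn1 cd1)
    (cD _ _ _ _ cn2 cd2 cn3 cd3)) cd5) (cvgM cn5
    (cvgM (cD _ _ _ _ cn4 cd4 cn3 cd3) (cD _ _ _ _ cn2 cd2 cn1 cd1)))).
have GE y : (exists2 k : C, k != 0 & n1 y = k * hnum (f1 y) /\ d1 y = k * hden (f1 y)) ->
    (exists2 k : C, k != 0 & n2 y = k * hnum (f2 y) /\ d2 y = k * hden (f2 y)) ->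
    (exists2 k : C, k != 0 & n3 y = k * hnum (f3 y) /\ d3 y = k * hden (f3 y)) ->
    (exists2 k : C, k != 0 & n4 y = k * hnum (f4 y) /\ d4 y = k * hden (f4 y)) ->
    (exists2 k : C, k != 0 & n5 y = k * hnum (f5 y) /\ d5 y = k * hden (f5 y)) ->
    G y = 0 <-> crossrel (f1 y) (f2 y) (f3 y) (f4 y) (f5 y).
  move=> [k1 k10 [e1 e1']] [k2 k20 [e2 e2']] [k3 k30 [e3 e3']].
  move=> [k4 k40 [e4 e4']] [k5 k50 [e5 e5']].
  have -> : G y = (k1 * k2 * k3 * k4 * k5) *
    (hdet (f4 y) (f1 y) * hdet (f2 y) (f3 y) * hden (f5 y) -
     hnum (f5 y) * (hdet (f4 y) (f3 y) * hdet (f2 y) (f1 y))).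
    by rewrite /G /D e1 e1' e2 e2' e3 e3' e4 e4' e5 e5' /hdet; ring.
  rewrite /crossrel; split=> [/eqP|->]; last by rewrite subrr mulr0.
  by rewrite mulf_eq0 !mulf_eq0 (negbTE k10) (negbTE k20) (negbTE k30)
    (negbTE k40) (negbTE k50) /= subr_eq0 => /eqP.
have Gx0 : G x != 0.
  by apply/eqP => /GE; move/(_ (nbhs_singleton h1) (nbhs_singleton h2)
    (nbhs_singleton h3) (nbhs_singleton h4) (nbhs_singleton h5)).
have Gn0 : \forall y \near x, G y != 0 by exact: cvgr_neq0 cG Gx0.
rewrite /interior /=; near=> y => /=.
have Gy0 : G y != 0 by near: y.
move=> cy; move/eqP: Gy0; apply; apply/GE => //; by near: y.
Unshelve. all: by end_near. Qed.

End CrossRatio.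

Section CrossMore.
Variable R : realType.
Local Notation S := (sphere R).

Lemma cross_of_proj (f : S -> S) a1 a2 a3 a : projective_iso f ->
  a1 != a2 -> a1 != a3 -> a2 != a3 ->
  cross (f a1) (f a2) (f a3) (f a) = cross a1 a2 a3 a.
Proof.
move=> pf a12 a13 a23; have fi := projective_iso_inj pf.
apply/crossrelP; rewrite ?(inj_eq fi) //.
by apply/(crossrel_proj _ _ _ _ _ pf)/crossrelP.
Qed.

(** Two distinct vertices see the leaves as in the hypotheses.  The [b i] being
    distinct, at least two of [a1], [a2], [a3] equal [p]; if there are exactly two
    and [a4] is not [p], then [b4] equals one of the [b i] and the cross-ratio is
    0, 1 or oo. *)
Lemma crossrel_or p q (a1 a2 a3 a4 b1 b2 b3 b4 : S) :
  b1 != b2 -> b1 != b3 -> b2 != b3 ->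
  a1 = p \/ b1 = q -> a2 = p \/ b2 = q -> a3 = p \/ b3 = q -> a4 = p \/ b4 = q ->
  crossrel a1 a2 a3 a4 (cross b1 b2 b3 b4).
Proof.
move=> b12 b13 b23.
case=> [->|e1]; case=> [->|e2]; case=> [->|e3]; case=> [->|e4];
  rewrite /crossrel ?hdetxx ?(mulr0, mul0r) //;
  try (by rewrite ?e1 ?e2 ?e3 eqxx in b12 b13 b23).
- by rewrite e4 -e3 cross3 /= mulr0.
- by rewrite e4 -e2 cross2 //= mulr1 mul1r.
- by rewrite e4 -e1 cross1 //= mul0r.
Qed.

(** When exactly two of the first three points coincide, the relation forces the
    fourth one to be the double point, or the cross-ratio to take the value
    attached to the third one. *)
Lemma crossrel12 (p a3 a4 z : S) :
  p != a3 -> crossrel p p a3 a4 z -> a4 = p \/ z = None.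
Proof.
move=> pa3; rewrite /crossrel hdetxx !mulr0 => /eqP.
rewrite !mulf_eq0 !hdet_eq0 (negbTE pa3) orbF => /orP[/eqP ->|]; first by left.
by case: z => [z|]; rewrite /= ?oner_eq0 //; right.
Qed.

Lemma crossrel13 (p a2 a4 z : S) :
  p != a2 -> crossrel p a2 p a4 z -> a4 = p \/ z = Some 1.
Proof.
move=> pa2; rewrite /crossrel => h.
have [->|ap] := eqVneq a4 p; [by left | right].
have h0 : hdet a4 p * hdet a2 p != 0 by rewrite mulf_neq0 // hdet_eq0 // eq_sym.
have : hden z = hnum z by apply: (mulfI h0); rewrite h mulrC.
by case: z {h} => [z /= <- //|/= /eqP]; rewrite eq_sym oner_eq0.
Qed.

Lemma crossrel23 (p a1 a4 z : S) :
  a1 != p -> crossrel a1 p p a4 z -> a4 = p \/ z = Some 0.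
Proof.
move=> pa1; rewrite /crossrel hdetxx mulr0 mul0r => /esym/eqP.
rewrite !mulf_eq0 !hdet_eq0 [p == _]eq_sym (negbTE pa1) orbF.
case/orP => [|/eqP ->]; last by left.
by case: z => [z|] /=; rewrite ?oner_eq0 // => /eqP ->; right.
Qed.

End CrossMore.

(** * The directions of a tree of spheres *)

Section TreeDirections.
Variables (R : realType) (E : finType) (T : sphereTree R E).
Local Notation V := (vertex T).
Local Notation adjT := (@adj E T).
Implicit Types (u w : V) (v m : 'I_(nint T)) (x y z : E).

(** [leafpos] extended to all the vertices: the point of the sphere at [v]
    towards [u]. *)
Definition pos v u : sphere R :=
  if [pick w : V | adj (inr v) w && same_comp v w u] is Some w
  then att v w else None.

Lemma same_compE v : same_comp v = avoid adjT (inr v).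
Proof. by []. Qed.

Let tsym := adj_sym (c0 := T).
Let tirr := adj_irrefl (c0 := T).
Let tconn := adj_connected (c0 := T).
Let tacyc := adj_acyclic (c0 := T).

Lemma pos_ex v u : u != inr v ->
  exists w, [/\ adjT (inr v) w, same_comp v w u & pos v u = att v w].
Proof.
move=> uv; rewrite /pos; case: pickP => [w /andP[vw wu]|none].
  by exists w.
have [w vw wu] := branch_exists tconn uv.
by have := none w; rewrite vw same_compE wu.
Qed.

Lemma pos_adj v w : adjT (inr v) w -> pos v w = att v w.
Proof.
move=> vw; have [|w' [vw' w'w ->]] := @pos_ex v w.
  by rewrite eq_sym (edge_neq tirr).
by rewrite (branch_unique tsym tirr tacyc vw' vw).
Qed.

Lemma pos_eq v u w : u != inr v -> w != inr v ->
  (pos v u == pos v w) = same_comp v u w.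
Proof.
move=> uv wv; have [a [va au ->]] := pos_ex uv; have [b [vb bw ->]] := pos_ex wv.
apply/eqP/idP => [e|uw].
  have ab : a = b by apply: (att_inj (v := v)).
  by rewrite ab same_compE avoid_sym // in au; exact: avoid_trans au bw.
congr att; apply: (branch_unique tsym tirr tacyc va vb).
apply: avoid_trans au _; apply: avoid_trans uw _.
by rewrite avoid_sym.
Qed.

Lemma pos_or v m u : v != m -> u != inr v -> u != inr m ->
  (pos v u == pos v (inr m)) || (pos m u == pos m (inr v)).
Proof.
move=> vm uv um; have mv : inr m != inr v :> V.
  by apply: contraNneq vm => -[->].
rewrite !pos_eq // 1?eq_sym //.
by apply: (avoid_or tconn); rewrite eq_sym.
Qed.

Definition is_leaf : pred V := fun u => if u is inl _ then true else false.

Lemma is_leafE w : is_leaf w -> forall a b, adjT w a -> adjT w b -> a = b.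
Proof.
case: w => // x _ a b xa xb; have /eqP/cards1P[c cE] := @valence_leaf E T x.
have : a \in [set c]%SET by rewrite -cE inE.
have : b \in [set c]%SET by rewrite -cE inE.
by rewrite !inE => /eqP -> /eqP ->.
Qed.

Lemma is_leafN w u : ~~ is_leaf w -> exists2 a, adjT w a & a != u.
Proof.
case: w => // v _; have h := @valence_int E T v.
have : ~~ ([set w | adjT (inr v) w]%SET \subset [set u]%SET).
  apply: contraL h => /subset_leq_card; rewrite cards1 -leqNgt => h.
  exact: leq_trans h _.
case/subsetPn => a; rewrite !inE => va au; by exists a.
Qed.

(** Beyond each of three edges at [v] there is a leaf. *)
Lemma pos_three v : exists x y z,
  [/\ pos v (inl x) != pos v (inl y), pos v (inl x) != pos v (inl z)
    & pos v (inl y) != pos v (inl z)].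
Proof.
have h := @valence_int E T v.
have [a [b [c [[va vb vc] ab ac bc]]]] : exists a b c, [/\ [/\ adjT (inr v) a,
    adjT (inr v) b & adjT (inr v) c], a != b, a != c & b != c].
  move: h; rewrite cardE; have := enum_uniq [set w | adjT (inr v) w]%SET.
  have := mem_enum [set w | adjT (inr v) w]%SET.
  case: (enum _) => [|a [|b [|c s]]] //= me.
  rewrite !inE !negb_or => /andP[/and3P[ab ac _] /andP[/andP[bc _] _]] _.
  exists a, b, c; split => //; split.
  - by have := me a; rewrite !inE eqxx /= => <-.
  - by have := me b; rewrite !inE eqxx /= ?orbT => <-.
  - by have := me c; rewrite !inE eqxx /= ?orbT => <-.
have lf w : adjT (inr v) w -> exists x, pos v (inl x) = pos v w.
  move=> vw; have [[x|//] _ wx] := leaf_beyond tsym tirr tconn tacyc is_leafN vw.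
  exists x; apply/eqP; rewrite pos_eq // 1?same_compE 1?avoid_sym //.
  by rewrite eq_sym (edge_neq tirr).
have [x xE] := lf _ va; have [y yE] := lf _ vb; have [z zE] := lf _ vc.
exists x, y, z; rewrite xE yE zE !pos_adj //.
by split; apply/negP => /eqP /(att_inj (v := v)); rewrite !inE => e;
  [move: ab | move: ac | move: bc]; rewrite e // eqxx.
Qed.

Lemma pos_median x y z : x != y -> x != z -> y != z -> exists v,
  [/\ pos v (inl x) != pos v (inl y), pos v (inl x) != pos v (inl z)
    & pos v (inl y) != pos v (inl z)].
Proof.
move=> xy xz yz.
have neqi (a b : E) : a != b -> inl a != inl b :> V by apply: contraNneq => -[->].
have [[x'|v] [] // _ nxy nxz nyz] := median_exists tsym tirr tconn tacyc is_leafE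
  (isT : is_leaf (inl x)) (isT : is_leaf (inl y)) (isT : is_leaf (inl z))
  (neqi _ _ xy) (neqi _ _ xz) (neqi _ _ yz).
by exists v; rewrite !pos_eq.
Qed.

(** The adjacency of a tree is determined by its directions. *)
Lemma adj_dadj u w : adjT u w = dadj pos u w.
Proof.
apply/idP/andP => [uw|[uw /forallP sep]].
  split; first exact: edge_neq uw; apply/forallP => m; apply/and3P => -[mu mw].
  by rewrite pos_eq 1?eq_sym // same_compE avoid_edge // eq_sym.
apply: (edge_of_avoid tsym tirr tconn tacyc uw) => -[x|m] mu mw.
  by apply: (leaf_avoid tsym tconn is_leafE); rewrite // eq_sym.
have := sep m; rewrite /dsep mu mw /= negbK pos_eq // eq_sym //.
Qed.

End TreeDirections.

(** A correspondence of the directions of the leaves is an isomorphism, because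
    it extends to the directions of all the vertices ([dirs_map]), and adjacency
    is defined by these. *)
Lemma isom_of_pos (R : realType) (E : finType) (T1 T2 : sphereTree R E)
  (mu : 'I_(nint T1) -> 'I_(nint T2)) (f : 'I_(nint T1) -> sphere R -> sphere R) :
  bijective mu -> (forall v, projective_iso (f v)) ->
  (forall v x, pos (mu v) (inl x) = f v (pos v (inl x))) -> isom T1 T2.
Proof.
move=> mub fp h; have fi v := projective_iso_inj (fp v).
exists mu, f; split => // [u w|v w vw].
  rewrite !adj_dadj; apply: dadj_map => //.
  - exact: pos_or.
  - exact: pos_three.
  - exact: pos_or.
have wv : w != inr v by rewrite eq_sym (edge_neq (adj_irrefl (c0 := T1))).
have e : pos (mu v) (extv mu w) = f v (pos v w).
  apply: dirs_map => //.
  - exact: pos_or.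
  - exact: pos_three.
  - exact: pos_or.
rewrite -(pos_adj vw) -e pos_adj //.
rewrite adj_dadj -[inr (mu v)]/(extv mu (inr v)).
rewrite (dadj_map (@pos_or _ _ T1) (@pos_three _ _ T1) (@pos_or _ _ T2) mub fi h).
by rewrite -adj_dadj.
Qed.

Section TreeOfDirections.
Variables (R : realType) (E : finType) (n : nat).
Variable d : 'I_n -> E + 'I_n -> sphere R.
Hypothesis dir_or : forall v m u, v != m -> u != inr v -> u != inr m ->
  (d v u == d v (inr m)) || (d m u == d m (inr v)).
Hypothesis dir_three : forall v, exists x y z,
  [/\ d v (inl x) != d v (inl y), d v (inl x) != d v (inl z)
    & d v (inl y) != d v (inl z)].
Hypothesis dir_median : forall x y z, x != y -> x != z -> y != z ->
  exists v, [/\ d v (inl x) != d v (inl y), d v (inl x) != d v (inl z)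
    & d v (inl y) != d v (inl z)].
Hypothesis E3 : (2 < #|E|)%N.

Let T0 := dir_tree dir_or dir_three dir_median E3.

Lemma dir_att_inj (v : 'I_(nint T0)) :
  {in [pred w | @adj E T0 (inr v) w] &, injective (d v)}.
Proof.
move=> a b; rewrite !inE => va vb e.
apply: (dadj_inj dir_or dir_three dir_median va vb) => v' [<-].
exact: e.
Qed.

Definition dir_sphereTree : sphereTree R E := SphereTree dir_att_inj.

Lemma pos_dir (v : 'I_n) (x : E) : @pos R E dir_sphereTree v (inl x) = d v (inl x).
Proof.
have [w [vw wx ->]] := @pos_ex R E dir_sphereTree v (inl x) isT.
apply/eqP; rewrite /=.
by have := avoid_dadj dir_or (v := v) (u := w) (w := inl x); move=> <- //;
  rewrite eq_sym; exact: dadj_neq vw.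
Qed.

End TreeOfDirections.

Section Coordinates.
Variables (R : realType) (E : finType).
Local Notation S := (sphere R).
Implicit Types (T : sphereTree R E) (x y z : E) (t : E * E * E).

Definition distinct t := uniq [:: t.1.1; t.1.2; t.2].

(** For [a = a_v], the vertex [v] is the one that separates [t]. *)
Definition splits (a : E -> S) t :=
  [&& a t.1.1 != a t.1.2, a t.1.1 != a t.2 & a t.1.2 != a t.2].

Lemma distinctP t : distinct t ->
  [/\ t.1.1 != t.1.2, t.1.1 != t.2 & t.1.2 != t.2].
Proof.
by rewrite /distinct /= !inE negb_or andbT => /andP[/andP[-> ->] ->].
Qed.

Lemma splits_proj (f : S -> S) (a b : E -> S) t : projective_iso f ->
  (forall x, b x = f (a x)) -> splits b t = splits a t.
Proof.
by move=> /projective_iso_inj fi ba; rewrite /splits !ba !(inj_eq fi).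
Qed.

Definition lpos T v x : S := pos (T := T) v (inl x).

Lemma separates_splits T t v : separates t v = splits (lpos (T := T) v) t.
Proof. by case: t => [[x0 x1] xoo]; rewrite /splits /= /lpos !pos_eq. Qed.

Lemma splits_ex T t : distinct t -> exists v, splits (lpos (T := T) v) t.
Proof.
move=> /distinctP[t12 t13 t23]; have [v [h1 h2 h3]] := pos_median T t12 t13 t23.
by exists v; apply/and3P.
Qed.

Lemma lpos_three T v : exists t, splits (lpos (T := T) v) t.
Proof.
have [x [y [z [h1 h2 h3]]]] := pos_three v.
by exists (x, y, z); apply/and3P.
Qed.

Lemma lpos_or T v m : v != m -> exists p q, forall x,
  lpos (T := T) v x = p \/ lpos m x = q.
Proof.
move=> vm; exists (pos v (inr m)), (pos m (inr v)) => x.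
by case/orP: (pos_or (u := inl x) vm isT isT) => /eqP; [left|right].
Qed.

(** If [v] and [m] were distinct, two of the three leaves would be in the
    direction of [m] seen from [v], or two in the direction of [v] seen from
    [m]. *)
Lemma splits_inj T t v m : splits (lpos (T := T) v) t -> splits (lpos m) t -> v = m.
Proof.
move=> /and3P[v12 v13 v23] /and3P[m12 m13 m23]; apply/eqP; apply: contraT => vm.
have [p [q h]] := lpos_or vm.
case: (h t.1.1) => e1; case: (h t.1.2) => e2; case: (h t.2) => e3;
by rewrite ?e1 ?e2 ?e3 eqxx in v12 v13 v23 m12 m13 m23.
Qed.

Definition crosst (a : E -> S) t x := cross (a t.1.1) (a t.1.2) (a t.2) (a x).

(** Since [sigma_t] is normalized at the images of [t], it computes the
    cross-ratio with them; hence [alpha_t] is expressed by [a_v] for the vertex [v]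
    separating [t]. *)
Lemma alphaE T t x v : splits (lpos (T := T) v) t ->
  alpha T t x = crosst (lpos v) t x.
Proof.
move=> vt; rewrite /alpha; case: pickP => [v'|/(_ v)]; last first.
  by rewrite separates_splits vt.
rewrite separates_splits => v't; have <- := splits_inj vt v't.
case: t vt {v't} => [[x0 x1] xoo] /and3P[/= h1 h2 h3].
have : normalizes (x0, x1, xoo) v (xget (fun z : S => z) (normalizes (x0, x1, xoo) v)).
  apply: xgetPex; exists (cross (lpos v x0) (lpos v x1) (lpos v xoo)); split.
  - exact: cross_proj.
  - exact: cross1.
  - exact: cross2.
  - exact: cross3.
move=> [pf f1 f2 f3]; apply/esym/crossrelP => //.
exact/(crossrel_normalized _ _ pf f1 f2 f3).
Qed.

(** An isomorphism maps branches to branches, hence directions to directions. *)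
Lemma isom_pos T1 T2 : isom T1 T2 ->
  exists mu : 'I_(nint T1) -> 'I_(nint T2), forall v, exists2 f, projective_iso f &
    forall x, lpos (mu v) x = f (lpos v x).
Proof.
move=> [mu [m [bmu amu pm cm]]]; exists mu => v; exists (m v) => // x.
have [w [vw wx e]] := @pos_ex _ _ T1 v (inl x) isT; rewrite /lpos e cm //.
have avw : adj (inr (mu v)) (extv mu w) by rewrite -[inr _]/(extv mu (inr v)) amu.
rewrite -(pos_adj avw); apply/eqP; rewrite pos_eq //; last first.
  by rewrite eq_sym (edge_neq (adj_irrefl (c0 := T2))).
have ext_inj : injective (extv mu : vertex T1 -> vertex T2).
  by move=> [a|a] [b|b] //= [] => [->|/(bij_inj bmu) ->].
have wv : w != inr v by rewrite eq_sym (edge_neq (adj_irrefl (c0 := T1))).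
rewrite same_compE avoid_sym; last exact: adj_sym.
have [p pth [_ vp lst]] := avoidP wv wx.
have -> : inl x = last (extv mu w) (map (extv mu) p).
  by rewrite last_map lst.
apply: avoid_path.
  by rewrite path_map (eq_path (e' := @adj E T1)).
by rewrite -map_cons -[inr _]/(extv mu (inr v)) (mem_map ext_inj).
Qed.

Lemma isom_alpha T1 T2 t x : isom T1 T2 -> distinct t -> alpha T1 t x = alpha T2 t x.
Proof.
move=> /isom_pos[mu h] /(splits_ex T1)[v vt]; have [f pf e] := h v.
rewrite (alphaE _ vt) (@alphaE _ _ _ (mu v)) ?(splits_proj _ pf e) //.
by case/and3P: vt => *; rewrite /crosst !e cross_of_proj.
Qed.

End Coordinates.

(** * The relations satisfied by the coordinates *)

(** Tychonoff's theorem and the projection lemmas ask for an index set with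
    decidable equality. *)
HB.instance Definition _ (E : finType) := gen_eqMixin (Quad E).

Section Image.
Variables (R : realType) (E : finType).
Local Notation S := (sphere R).
Local Notation X := (prod_topology (fun _ : Quad E => S)).
Implicit Types (T : sphereTree R E) (x y z : E) (s t : E * E * E) (b : X).

Definition quad (x0 x1 xoo x : E) (u : uniq [:: x0; x1; xoo; x]) : Quad E :=
  exist _ (x0, x1, xoo, x) u.

(** The family [b], which is indexed by quadruples of distinct leaves, completed
    by the values 0, 1, oo that the maps [alpha_t] take on [t]. *)
Definition coord b t x : S :=
  if x == t.1.1 then Some 0 else if x == t.1.2 then Some 1
  else if x == t.2 then None
  else let: (x0, x1, xoo) := t in
    if @idP (uniq [:: x0; x1; xoo; x]) is ReflectT u then b (quad u) else None.

(** With [coord], the relations can be imposed without excluding the leaves [x]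
    that belong to [t]. *)
Definition cross_set : set X := [set b | forall s t x, distinct s -> distinct t ->
  crossrel (coord b s t.1.1) (coord b s t.1.2) (coord b s t.2) (coord b s x)
    (coord b t x)].

Lemma coord_quad b (q : Quad E) :
  coord b (sval q).1 (sval q).2 = b q.
Proof.
case: q => [[[[x0 x1] xoo] x] u]; change (coord b (x0, x1, xoo) x = b (quad u)).
have [h1 h2 h3] : [/\ x != x0, x != x1 & x != xoo].
  have : uniq [:: x0; x1; xoo; x] := u.
  rewrite /= !inE !negb_or => /and4P[/and3P[_ _ h1] /andP[_ h2] h3 _].
  by split; rewrite eq_sym.
rewrite /coord (ifN _ _ h1) (ifN _ _ h2) (ifN _ _ h3).
case: {-}_ / idP => [u'|/(_ u) //].
by rewrite (bool_irrelevance u' u).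
Qed.

Lemma coord_of (a : E -> S) b t x : distinct t ->
  a t.1.1 = Some 0 -> a t.1.2 = Some 1 -> a t.2 = None ->
  (forall q : Quad E, (sval q).1 = t -> b q = a (sval q).2) ->
  coord b t x = a x.
Proof.
move=> dt a1 a2 a3 ba; rewrite /coord.
have [->//|x1] := eqVneq x t.1.1; have [->//|x2] := eqVneq x t.1.2.
have [->//|x3] := eqVneq x t.2.
case: t dt a1 a2 a3 x1 x2 x3 ba => [[x0 x1] xoo] dt _ _ _ xx0 xx1 xxoo ba.
case: {-}_ / idP => [u|]; first by rewrite ba.
move: dt xx0 xx1 xxoo; rewrite /distinct /= !inE !negb_or.
move=> /andP[/andP[-> ->] /andP[-> _]].
by rewrite ![x == _]eq_sym => -> -> ->.
Qed.

Lemma coord_normal b t : distinct t -> [/\ coord b t t.1.1 = Some 0,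
  coord b t t.1.2 = Some 1 & coord b t t.2 = None].
Proof.
move=> /distinctP[t12 t13 t23]; rewrite /coord !eqxx.
by rewrite [t.2 == _]eq_sym (negbTE t13) [t.2 == _]eq_sym (negbTE t23)
  eq_sym (negbTE t12).
Qed.

Lemma coord_splits b t : distinct t -> splits (coord b t) t.
Proof.
move=> /(coord_normal b)[e1 e2 e3]; have h01 : (Some 0 : S) != Some 1.
  by apply/eqP => -[] /esym/eqP; rewrite oner_eq0.
by rewrite /splits e1 e2 e3 h01.
Qed.

Lemma coord_alpha T b t x : distinct t ->
  (forall q : Quad E, b q = alpha T (sval q).1 (sval q).2) ->
  coord b t x = alpha T t x.
Proof.
move=> dt bE; have [v vt] := splits_ex T dt.
case/and3P: (vt) => h1 h2 h3.
apply: coord_of => // [||| q <-].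
- by rewrite (alphaE _ vt) /crosst cross1.
- by rewrite (alphaE _ vt) /crosst cross2.
- by rewrite (alphaE _ vt) /crosst cross3.
- exact: bE.
Qed.

Lemma BEE (c : Mod R E) (q : Quad E) : BE c q = alpha (repr c) (sval q).1 (sval q).2.
Proof. by rewrite /BE; case: (sval q). Qed.

Lemma BE_cross_set (c : Mod R E) : cross_set (BE c).
Proof.
move=> s t x ds dt; rewrite !(coord_alpha _ _ (BEE c)) //.
have [v vs] := splits_ex (repr c) ds; have [m mt] := splits_ex (repr c) dt.
rewrite !(alphaE _ vs) (alphaE _ mt).
case/and3P: vs => v1 v2 v3; case/and3P: (mt) => m1 m2 m3.
apply/(crossrel_proj _ _ _ _ _ (cross_proj v1 v2 v3)).
have [<-|vm] := eqVneq m v; first exact/crossrelP.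
have [p [q h]] := lpos_or vm.
by apply: (@crossrel_or _ q p) => //; case: (h t.1.1) (h t.1.2) (h t.2) (h x) =>
  ? [] ? [] ? [] ?; by [left|right].
Qed.

Lemma cross_set_closed : closed cross_set.
Proof.
have cc t x : continuous (fun b : X => coord b t x).
  rewrite /coord; case: eqP => _; first exact: cst_continuous.
  case: eqP => _; first exact: cst_continuous.
  case: eqP => _; first exact: cst_continuous.
  case: t => [[x0 x1] xoo]; case: {-}_ / idP => [u|_]; last exact: cst_continuous.
  exact: (@proj_continuous (Quad E) (fun=> S) (quad u)).
have -> : cross_set = \bigcap_(p in [set p : (E * E * E) * (E * E * E) * E |
    distinct p.1.1 /\ distinct p.1.2]) [set b |
   crossrel (coord b p.1.1 p.1.2.1.1) (coord b p.1.1 p.1.2.1.2)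
     (coord b p.1.1 p.1.2.2) (coord b p.1.1 p.2) (coord b p.1.2 p.2)].
  apply/seteqP; split=> b h.
    by move=> [[s t] x] [/= ds dt]; exact: h.
  by move=> s t x ds dt; exact: (h (s, t, x) (conj ds dt)).
by apply: closed_bigI => p _; apply: closed_crossrel.
Qed.

(** * Reconstruction of a tree from its coordinates *)

Section Reconstruct.
Variable b : X.
Hypothesis bZ : cross_set b.
Local Notation A := (coord b).

Lemma splits_trans s t : distinct s -> distinct t -> splits (A s) t ->
  exists2 f : S -> S, projective_iso f & forall x, A t x = f (A s x).
Proof.
move=> ds dt /and3P[h1 h2 h3].
exists (cross (A s t.1.1) (A s t.1.2) (A s t.2)); first exact: cross_proj.
by move=> x; apply/esym/crossrelP => //; exact: bZ.
Qed.

Lemma splits_sym s t : distinct s -> distinct t -> splits (A s) t -> splits (A t) s.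
Proof.
move=> ds dt st; have [f pf e] := splits_trans ds dt st.
by rewrite (splits_proj _ pf e) coord_splits.
Qed.

(** If exactly two of the values of [A s] on [t] coincide, the relations between
    [s] and [t] give [p] and [q]; if the three coincide, they are void. *)
Lemma partial_split s t : distinct s -> distinct t -> ~~ splits (A s) t ->
  (exists p q, forall x, A s x = p \/ A t x = q) \/
  [/\ A s t.1.2 = A s t.1.1 & A s t.2 = A s t.1.1].
Proof.
move=> ds dt; have h x := bZ x ds dt.
have [e12|n12] := eqVneq (A s t.1.2) (A s t.1.1).
  have [e13|n13] := eqVneq (A s t.2) (A s t.1.1); first by right.
  left; exists (A s t.1.1), None => x.
  by have := h x; rewrite e12; apply: crossrel12; rewrite eq_sym.
have [e13|n13] := eqVneq (A s t.2) (A s t.1.1).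
  left; exists (A s t.1.1), (Some 1) => x.
  by have := h x; rewrite e13; apply: crossrel13; rewrite eq_sym.
have [e23|n23] := eqVneq (A s t.2) (A s t.1.2).
  left; exists (A s t.1.2), (Some 0) => x.
  by have := h x; rewrite e23; apply: crossrel23; rewrite eq_sym.
by rewrite /splits eq_sym n12 eq_sym n13 eq_sym n23.
Qed.

(** The remaining case is when [A s] is constant, equal to [p], on [t], and [A t]
    constant, equal to [q], on [s].  Suppose that [A s x] is not [p] and [A t x] is
    not [q].  Replacing one of the elements of [t] by [x] gives a triple [r] with
    [A r] projectively equivalent to [A t], and [A s] takes exactly two values on
    [r]; so the relations between [s] and [r] are not void.  They say that each
    leaf [w] has [A s w = p] or [A t w = A t x]; applied to the elements of [s],
    they force [A s] to be constant on [s]. *)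
Lemma splits_or s t : distinct s -> distinct t -> ~~ splits (A s) t ->
  exists p q, forall x, A s x = p \/ A t x = q.
Proof.
move=> ds dt nst; have nts : ~~ splits (A t) s.
  by apply: contra nst; exact: splits_sym.
case: (partial_split ds dt nst) => [//|[s12 s13]].
case: (partial_split dt ds nts) => [[q [p h]]|[t12 t13]].
  by exists p, q => x; case: (h x); [right|left].
pose p := A s t.1.1; pose q := A t s.1.1; exists p, q.
apply: contrapT => /existsNP[x /not_orP[/eqP xp /eqP xq]].
have [y [z [yp zp yz yx zx]]] : exists y z, [/\ A s y = p, A s z = p,
    A t y != A t z, A t y != A t x & A t z != A t x].
  case/and3P: (coord_splits b dt) => h12 h13 h23.
  have [e1|n1] := eqVneq (A t t.1.1) (A t x).
    by exists t.1.2, t.2; split=> //; rewrite -e1 eq_sym.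
  have [e2|n2] := eqVneq (A t t.1.2) (A t x).
    by exists t.1.1, t.2; split=> //; rewrite -e2 eq_sym.
  by exists t.1.1, t.1.2.
pose r := (y, z, x).
have dr : distinct r.
  rewrite /distinct /= !inE negb_or andbT -andbA; apply/and3P; split.
  - by apply: contraNneq yz => ->.
  - by apply: contraNneq yx => ->.
  - by apply: contraNneq zx => ->.
have [f /projective_iso_inj fi rt] : exists2 f : S -> S, projective_iso f &
    forall x, A r x = f (A t x).
  by apply: splits_trans => //; apply/and3P.
have key w : A s w = p \/ A t w = A t x.
  have := bZ w ds dr; rewrite /= yp zp => /crossrel12.
  rewrite eq_sym => /(_ xp) [|e]; [by left|right].
  by apply: fi; rewrite -!rt e; case: (coord_normal b dr).
have sq w : w \in [:: s.1.1; s.1.2; s.2] -> A s w = p.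
  have tq : A t w != A t x -> A s w = p by case: (key w) => // ->; rewrite eqxx.
  rewrite !inE => /or3P[] /eqP wE; apply: tq; rewrite wE ?t12 ?t13 eq_sym //.
case/and3P: (coord_splits b ds).
by rewrite !sq ?inE ?eqxx ?orbT.
Qed.

(** Any maximal family of triples none of which splits another one will do: a
    triple outside of it splits or is split by some member, and splitting is
    symmetric. *)
Lemma splitting_family : exists I : {set E * E * E},
  [/\ forall t, t \in I -> distinct t,
      {in I &, forall s t, s != t -> ~~ splits (A s) t} &
      forall t, distinct t -> exists2 s, s \in I & splits (A s) t].
Proof.
pose P (I : {set E * E * E}) := [forall t in I, distinct t] &&
  [forall s in I, forall t in I, (s != t) ==> ~~ splits (A s) t].
have P0 : P finset.set0.
  by apply/andP; split; apply/forall_inP => t; rewrite inE.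
have [I /maxsetP[/andP[/forall_inP dI /forall_inP nI] maxI] _] := maxset_exists P0.
have nI' : {in I &, forall s t, s != t -> ~~ splits (A s) t}.
  by move=> s t sI tI; have /forall_inP/(_ t tI)/implyP := nI s sI.
exists I; split=> // t dt.
apply: contrapT => none.
have nst s : s \in I -> ~~ splits (A s) t.
  by move=> sI; apply/negP => st; apply: none; exists s.
have tI : t \notin I by apply/negP => /nst; rewrite coord_splits.
case/negP: tI; rewrite -(maxI (t |: I)%SET) ?setU11 ?finset.subsetUr //.
apply/andP; split; apply/forall_inP => s /setU1P[->|sI] //; first exact: dI.
  apply/forall_inP => r /setU1P[->|rI]; apply/implyP; first by rewrite eqxx.
  by move=> _; apply/negP => /(splits_sym dt (dI _ rI)); rewrite (negbTE (nst _ rI)).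
apply/forall_inP => r /setU1P[->|rI]; apply/implyP.
  by move=> _; exact: nst.
exact: nI'.
Qed.

Hypothesis E3 : (2 < #|E|)%N.

(** The internal vertices are the members of a splitting family, and the maps
    [A t] prescribe the directions of the leaves. *)
Lemma cross_set_tree : exists T, forall q : Quad E, b q = alpha T (sval q).1 (sval q).2.
Proof.
have [I [dI nI fI]] := splitting_family.
pose a (v : 'I_#|I|) := A (enum_val v).
have dv (v : 'I_#|I|) : distinct (enum_val v) by apply/dI/enum_valP.
have a_or v m : v != m -> exists p q, forall x, a v x = p \/ a m x = q.
  move=> vm; apply: splits_or => //; apply: nI; rewrite ?enum_valP //.
  by rewrite (inj_eq enum_val_inj).
have a_three v : exists x y z, [/\ a v x != a v y, a v x != a v z & a v y != a v z].
  case/and3P: (coord_splits b (dv v)) => h1 h2 h3.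
  by exists (enum_val v).1.1, (enum_val v).1.2, (enum_val v).2.
have a_median x y z : x != y -> x != z -> y != z ->
    exists v, [/\ a v x != a v y, a v x != a v z & a v y != a v z].
  move=> xy xz yz; have [|s sI /and3P[h1 h2 h3]] := fI (x, y, z).
    by rewrite /distinct /= !inE negb_or xy xz yz.
  by exists (enum_rank_in sI s); rewrite /a enum_rankK_in.
pose T := @dir_sphereTree R E #|I| (dirs None a) (dirs_or None a_or a_three)
  a_three a_median E3.
exists T => q; rewrite -coord_quad.
move: (sval q) (proj2_sig q) => [t x] /= dtx.
have dt : distinct t.
  move: dtx; case: (t) => [[x0 x1] xoo]; rewrite /distinct /= !inE !negb_or.
  by move=> /and4P[/and3P[-> -> _] /andP[-> _] _ _].
have [s sI st] := fI t dt.
have lE (v : 'I_#|I|) y : @lpos R E T v y = a v y by exact: pos_dir.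
pose v : 'I_#|I| := enum_rank_in sI s.
have av : a v = A s by rewrite /a /v enum_rankK_in.
rewrite (@alphaE _ _ T t x v); last by rewrite /splits !lE av.
rewrite /crosst !lE av; apply/esym; case/and3P: st => h1 h2 h3.
by apply/crossrelP => //; apply: bZ => //; exact: dI.
Qed.

End Reconstruct.

(** A class is represented by some tree isomorphic to the given one, and the
    coordinates do not change under isomorphism. *)
Lemma range_BE : (2 < #|E|)%N -> range (@BE R E) = cross_set.
Proof.
move=> E3; apply/seteqP; split=> [_ [c _ <-]|b bZ]; first exact: BE_cross_set.
have [T TE] := cross_set_tree bZ E3.
exists (\pi_(Mod R E) T)%qT => //; apply/functional_extensionality_dep => q.
rewrite BEE TE; apply: isom_alpha.
  have /eqmodP/asboolP : repr (\pi_(Mod R E) T)%qT = T %[mod Mod R E]%qT by rewrite reprK.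
  by [].
case: q => -[[[x0 x1] xoo] x]; rewrite /distinct /= !inE !negb_or.
by move=> /and4P[/and3P[-> -> _] /andP[-> _] _ _].
Qed.

(** A vertex of [T1] separates some triple [t], and corresponds to the vertex of
    [T2] that separates [t].  Both [a_v] are obtained from [alpha_t] by
    projective maps, so the correspondence does not depend on [t] and is
    bijective. *)
Lemma alpha_isom T1 T2 : (forall t x, distinct t -> alpha T1 t x = alpha T2 t x) ->
  isom T1 T2.
Proof.
have ex T T' : (forall t x, distinct t -> alpha T t x = alpha T' t x) ->
    forall v, exists m, exists2 f : S -> S, projective_iso f &
      forall x, @lpos R E T' m x = f (lpos (T := T) v x).
  move=> h v; have [t vt] := lpos_three v.
  case/and3P: (vt) => v1 v2 v3.
  have dt : distinct t.
    rewrite /distinct /= !inE negb_or andbT -andbA; apply/and3P; split.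
    - by apply: contraNneq v1 => ->.
    - by apply: contraNneq v2 => ->.
    - by apply: contraNneq v3 => ->.
  have [m mt] := splits_ex T' dt; exists m.
  case/and3P: (mt) => m1 m2 m3.
  have [g pg gK] := projective_iso_inv (cross_proj m1 m2 m3).
  exists (g \o cross (lpos v t.1.1) (lpos v t.1.2) (lpos v t.2)).
    exact: projective_iso_comp pg (cross_proj v1 v2 v3).
  move=> x /=; have := h t x dt; rewrite (alphaE _ vt) (alphaE _ mt) /crosst => ->.
  by rewrite gK.
have un T (v v' : 'I_(nint T)) (f : S -> S) : projective_iso f ->
    (forall x, lpos v' x = f (lpos v x)) -> v' = v.
  move=> pf e; have [t vt] := lpos_three v.
  by apply: (splits_inj (t := t)) => //; rewrite (splits_proj _ pf e).
move=> h; have /boolp.choice[mu muP] := ex _ _ h.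
have /boolp.choice[nu nuP] := ex T2 T1 (fun t x dt => esym (h t x dt)).
have /boolp.choice[f fP] : forall v, exists f : S -> S, projective_iso f /\
    forall x, lpos (mu v) x = f (lpos v x).
  by move=> v; have [f] := muP v; exists f.
apply: (@isom_of_pos _ _ _ _ mu f) => [|v|v x]; first last.
- by have [_ /(_ x)] := fP v.
- by case: (fP v).
exists nu => v.
  have [g pg gE] := nuP (mu v); have [pf fE] := fP v.
  by apply: (un _ _ _ (g \o f v)) => [|x]; [exact: projective_iso_comp | rewrite gE fE].
have [g pg gE] := nuP v; have [pf fE] := fP (nu v).
by apply: (un _ _ _ (f (nu v) \o g)) => [|x]; [exact: projective_iso_comp | rewrite fE gE].
Qed.

Lemma BE_inj : injective (@BE R E).
Proof.
move=> c1 c2 e; rewrite -[c1]reprK -[c2]reprK; apply/eqmodP/asboolP/alpha_isom.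
move=> t x dt.
by rewrite -(coord_alpha _ dt (BEE c1)) -(coord_alpha _ dt (BEE c2)) e.
Qed.

End Image.

(** * Compactness *)

Lemma compact_initial (M : choiceType) (X : topologicalType) (f : M -> X) :
  compact (range f) -> compact [set: initial_topology f].
Proof.
move=> cf F PF _; have [|_ [[c _ <-] cl]] := cf (f @ F) _.
  by apply: (@filterE _ F) => c; exists c.
exists c; split=> // U V FU Vc.
move: Vc => [_ [[W oW <-] Wc WV]].
have fFU : F (f @^-1` (f @` U)).
  by apply: (filterS _ FU) => u Uu; exists u.
have [w [[u Uu uw] Ow]] := cl _ _ fFU (open_nbhs_nbhs (conj oW Wc)).
by exists u; split=> //; apply: WV; rewrite /= uw.
Qed.

Lemma hausdorff_initial (M : choiceType) (X : topologicalType) (f : M -> X) :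
  injective f -> hausdorff_space X -> hausdorff_space (initial_topology f).
Proof.
move=> fi hX c c' cl; apply: fi; apply: hX => U V Uc Vc'.
have [p [pU pV]] :=
  cl _ _ (initial_continuous (f := f) Uc) (initial_continuous (f := f) Vc').
by exists (f p).
Qed.

Theorem mainTheorem2 (R : realType) (E : finType) (hE : (3 <= #|E|)%N) :
  compact [set: initial_topology (@BE R E)] /\
  hausdorff_space (initial_topology (@BE R E)).
Proof.
split.
  apply: compact_initial; rewrite (range_BE R hE).
  apply: (subclosed_compact (B := [set: prod_topology (fun _ : Quad E => sphere R)])) => //.
    exact: cross_set_closed.
  have := @tychonoff (Quad E) (fun=> sphere R) (fun=> setT) (fun=> @sphere_compact R).
  by congr compact; apply/seteqP; split.
apply: hausdorff_initial; first exact: BE_inj.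
by apply: (@hausdorff_product (Quad E) (fun=> sphere R)) => _; exact: sphere_hausdorff.
Qed.
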